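(* Take a finite $E \subseteq \mathbb{E}$ and $e, f \in E$ (with $e,f\in\mathbb{E}_{\mathsf{K}}$). The following are equivalent: \begin{enumerate} \item $e \equiv_{\mathsf{K}} f$ \item $[\![ e ]\!]_{\Gamma} = [\![ f ]\!]_{\Gamma}$ where $\Gamma$ is the Fischer--Ladner closure of $\mathrm{St}(E)$ \item $[\![ e ]\!]_M = [\![ f ]\!]_M$ for all relational models $M$ \end{enumerate}
   Context: Fix countably infinite disjoint alphabets $\Sigma$ (atomic actions) and $\Pi$ (atomic propositions). The set $\mathbb{E}$ of expressions is given by $e,f ::= \mathtt{a}\in\Sigma \mid \mathtt{p}\in\Pi \mid \mathtt{0} \mid \mathtt{1} \mid e+f \mid e\cdot f \mid e^{\bot} \mid e^{\top} \mid e^{*}$ ($^{\bot}$ antidomain, $^{\top}$ domain). Formulas: $\phi,\psi ::= \mathtt{p} \mid \mathtt{0}\mid\mathtt{1}\mid \phi+\psi \mid \phi\cdot\psi \mid e^{\bot} \mid e^{\top}$. $\equiv$ is the smallest congruence on $\mathbb{E}$ satisfying the Kleene algebra axioms (idempotent semiring laws, $\mathtt{1}+e\cdot e^{*}\leqq e^{*}$, $\mathtt{1}+e^{*}\cdot e\leqq e^{*}$, $f+e\cdot g\leqq g \Rightarrow e^{*}\cdot f\leqq g$, $f+g\cdot e\leqq g\Rightarrow f\cdot e^{*}\leqq g$) together with $e^{\bot}\cdot e\equiv\mathtt{0}$, $(e\cdot f)^{\bot}\equiv(e\cdot f^{\top})^{\bot}$, $e^{\bot}+e^{\top}\equiv\mathtt{1}$,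 $\mathtt{p}^{\top}\equiv\mathtt{p}$, $e^{\top}\equiv e^{\bot\bot}$; $e\leqq f$ means $e+f\equiv f$. $\mathbb{E}_{\mathsf{K}}\subseteq\mathbb{E}$ is any of the syntactic fragments considered (e.g. regular expressions over $\Sigma$ for $\mathsf{KA}$; with $^{\top}$ and/or $^{\bot}$ for $\mathsf{dKA},\mathsf{aKA}$; $\mathsf{KAT}$-expressions with $^{\bot}$ only on $\Pi$; etc.), and $e\equiv_{\mathsf{K}} f$ means $e,f\in\mathbb{E}_{\mathsf{K}}$ and $e\equiv f$. Relational models $M=\langle X,\mathsf{rel}_M,\mathsf{sat}_M\rangle$ ($\mathsf{rel}_M:\Sigma\to 2^{X\times X}$, $\mathsf{sat}_M:\Pi\to 2^X$) interpret expressions by $[\![ \mathtt{a} ]\!]_M=\mathsf{rel}_M(\mathtt{a})$, $[\![ \mathtt{p} ]\!]_M$ = identity on $\mathsf{sat}_M(\mathtt{p})$, $\mathtt{0}\mapsto\emptyset$, $\mathtt{1}\mapsto 1_X$, union, composition, reflexive transitive closure, $[\![ e^{\bot} ]\!]_M=\{\langle x,x\rangle\mid\neg\exists y\,\langle x,y\rangle\in[\![ e ]\!]_M\}$, $[\![ e^{\top} ]\!]_M=\{\langle x,x\rangle\mid\exists y\,\langle x,y\rangle\in[\![ e ]\!]_M\}$. A test is $e^{\top}$ with $e$ containing no $^{\top}$; a parameter is a test or element of $\Pi$. For $e$, $e?:=f^{\top}$ where $f$ is $e$ with every $^{\top}$ replaced by $^{\bot\bot}$; $\mathrm{St}(E)=\{f?\mid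 f$ a subexpression of some $e\in E$ that is a formula$\}$. A set $\Gamma$ of parameters is Fischer--Ladner closed iff: $\mathtt{p}^{\top}\in\Gamma\Rightarrow\mathtt{p}\in\Gamma$; $\mathtt{1}^{\top},\mathtt{0}^{\top}\in\Gamma$; $(\phi+\psi)^{\top}$ or $(\phi\cdot\psi)^{\top}\in\Gamma\Rightarrow\phi^{\top},\psi^{\top}\in\Gamma$; $(e^{*})^{\top}\in\Gamma\Rightarrow e^{\top}\in\Gamma$; if $e\neq f\cdot\mathtt{1}$, $e^{\top}\in\Gamma\Rightarrow(e\cdot\mathtt{1})^{\top}\in\Gamma$; $e^{\bot\top}\in\Gamma\Rightarrow(e\cdot\mathtt{1})^{\top}\in\Gamma$; $((e+f)\cdot\phi)^{\top}\in\Gamma\Rightarrow(e\cdot\phi)^{\top},(f\cdot\phi)^{\top}\in\Gamma$; $((e\cdot f)\cdot\phi)^{\top}\in\Gamma\Rightarrow(f\cdot\phi)^{\top},(e\cdot(f\cdot\phi)^{\bot\bot})^{\top}\in\Gamma$; $(e^{*}\cdot\phi)^{\top}\in\Gamma\Rightarrow(e\cdot(e^{*}\cdot\phi)^{\bot\bot})^{\top}\in\Gamma$. FL-closure = smallest FL-closed superset. For finite $\Gamma=\{\phi_1,\dots,\phi_n\}$ of parameters, atoms are $\psi_1\cdots\psi_n$ with $\psi_i\in\{\phi_i,\phi_i^{\bot}\}$ (as products); consistent iff $\not\equiv\mathtt{0}$; $\mathbb{C}(\Gamma)$ = consistent atoms; $\mathbb{CS}(\Gamma)$ = strings $G_1\mathtt{a}_1\cdots\mathtt{a}_{n-1}G_n$,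 $G_i\in\mathbb{C}(\Gamma)$, $\mathtt{a}_j\in\Sigma$. Fusion $xG\diamond Hy=xGy$ if $G=H$ (else undefined), lifted to sets. $\mathbf{CL}(\Gamma)$: subsets of $\mathbb{CS}(\Gamma)$ with $\cup$, $\diamond$, $K^{*}=\bigcup_nK^n$ ($K^0=\mathbb{C}(\Gamma)$), $L^{\bot}=\{G\in\mathbb{C}(\Gamma)\mid\{G\}\diamond L=\emptyset\}$, $L^{\top}=\{G\in\mathbb{C}(\Gamma)\mid\{G\}\diamond L\ne\emptyset\}$, zero $\emptyset$, one $\mathbb{C}(\Gamma)$. The canonical $\Gamma$-interpretation $[\![ - ]\!]_{\Gamma}:\mathbb{E}\to\mathbf{CL}(\Gamma)$ is the unique homomorphism with $[\![ \mathtt{a} ]\!]_{\Gamma}=\{G\mathtt{a}H\in\mathbb{CS}(\Gamma)\mid G\mathtt{a}H\not\equiv\mathtt{0}\}$, $[\![ \mathtt{p} ]\!]_{\Gamma}=\{G\in\mathbb{C}(\Gamma)\mid G\leqq\mathtt{p}\}$.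
   Formalization: As defined, the Fischer–Ladner closure Γ can be infinite (e.g. once (a·b)^⊤ is in it), so atoms are undefined; here atoms are built from any finite list of members of Γ representing every member up to ≡, and such a list is proved to exist. *)

(* Defs.v *)
From Stdlib Require List Relation_Operators.
From mathcomp Require Import all_boot.
From mathcomp Require Import boolp classical_sets cardinality.

Local Open Scope classical_set_scope.

Inductive expr (Sigma Pi : Type) : Type :=
| Act of Sigma
| Prp of Pi
| Zero
| One
| Add of expr Sigma Pi & expr Sigma Pi
| Mul of expr Sigma Pi & expr Sigma Pi
| Bot of expr Sigma Pi
| Top of expr Sigma Pi
| Star of expr Sigma Pi.
Arguments Act {Sigma Pi} _.
Arguments Prp {Sigma Pi} _.
Arguments Zero {Sigma Pi}.
Arguments One {Sigma Pi}.
Arguments Add {Sigma Pi} _ _.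
Arguments Mul {Sigma Pi} _ _.
Arguments Bot {Sigma Pi} _.
Arguments Top {Sigma Pi} _.
Arguments Star {Sigma Pi} _.

Declare Scope kad_scope.
Delimit Scope kad_scope with kad.
Bind Scope kad_scope with expr.
Notation "0" := Zero : kad_scope.
Notation "1" := One : kad_scope.
Notation "e + f" := (Add e f) : kad_scope.
Notation "e * f" := (Mul e f) : kad_scope.

Reserved Notation "e === f" (at level 70, no associativity).
Reserved Notation "e <<= f" (at level 70, no associativity).

Inductive keq {Sigma Pi : Type} : expr Sigma Pi -> expr Sigma Pi -> Prop :=
| keq_refl e : e === e
| keq_sym e f : e === f -> f === e
| keq_trans e f g : e === f -> f === g -> e === g
| keq_add e e' f f' : e === e' -> f === f' -> e + f === e' + f'
| keq_mul e e' f f' : e === e' -> f === f' -> e * f === e' * f'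
| keq_bot e e' : e === e' -> Bot e === Bot e'
| keq_top e e' : e === e' -> Top e === Top e'
| keq_star e e' : e === e' -> Star e === Star e'
| keq_addA e f g : e + (f + g) === (e + f) + g
| keq_addC e f : e + f === f + e
| keq_add0 e : e + 0 === e
| keq_addI e : e + e === e
| keq_mulA e f g : e * (f * g) === (e * f) * g
| keq_mul1l e : 1 * e === e
| keq_mul1r e : e * 1 === e
| keq_mul0l e : 0 * e === 0
| keq_mul0r e : e * 0 === 0
| keq_mulDl e f g : (e + f) * g === e * g + f * g
| keq_mulDr e f g : e * (f + g) === e * f + e * g
| keq_star_unfoldl e : 1 + e * Star e <<= Star e
| keq_star_unfoldr e : 1 + Star e * e <<= Star e
| keq_star_indl e f g : f + e * g <<= g -> Star e * f <<= g
| keq_star_indr e f g : f + g * e <<= g -> f * Star e <<= g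
| keq_bot_mul e : Bot e * e === 0
| keq_bot_local e f : Bot (e * f) === Bot (e * Top f)
| keq_bot_top e : Bot e + Top e === 1
| keq_top_prp p : Top (Prp p) === Prp p
| keq_top_botbot e : Top e === Bot (Bot e)
where "e === f" := (keq e%kad f%kad)
and "e <<= f" := (keq (e + f)%kad f%kad).

Definition keq_in {Sigma Pi : Type} (K : set (expr Sigma Pi))
    (e f : expr Sigma Pi) : Prop :=
  [/\ K e, K f & e === f].

Record relModel (Sigma Pi : Type) : Type := RelModel {
  carrier : Type;
  rel_of : Sigma -> set (carrier * carrier);
  sat_of : Pi -> set carrier }.
Arguments carrier {Sigma Pi} _.
Arguments rel_of {Sigma Pi} _ _.
Arguments sat_of {Sigma Pi} _ _.

Fixpoint rel_interp {Sigma Pi : Type} (M : relModel Sigma Pi)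
    (e : expr Sigma Pi) : set (carrier M * carrier M) :=
  match e with
  | Act a => rel_of M a
  | Prp p => [set xy | xy.1 = xy.2 /\ sat_of M p xy.1]
  | Zero => set0
  | One => [set xy | xy.1 = xy.2]
  | Add e1 e2 => rel_interp M e1 `|` rel_interp M e2
  | Mul e1 e2 => [set xz | exists y, rel_interp M e1 (xz.1, y) /\
                                     rel_interp M e2 (y, xz.2)]
  | Bot e1 => [set xy | xy.1 = xy.2 /\ ~ exists y, rel_interp M e1 (xy.1, y)]
  | Top e1 => [set xy | xy.1 = xy.2 /\ exists y, rel_interp M e1 (xy.1, y)]
  | Star e1 => [set xy | Relation_Operators.clos_refl_trans _
                           (fun x y => rel_interp M e1 (x, y)) xy.1 xy.2]
  end.

Fixpoint is_formula {Sigma Pi : Type} (e : expr Sigma Pi) : bool :=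
  match e with
  | Act _ | Star _ => false
  | Prp _ | Zero | One | Bot _ | Top _ => true
  | Add e1 e2 | Mul e1 e2 => is_formula e1 && is_formula e2
  end.

Fixpoint top_free {Sigma Pi : Type} (e : expr Sigma Pi) : bool :=
  match e with
  | Act _ | Prp _ | Zero | One => true
  | Top _ => false
  | Add e1 e2 | Mul e1 e2 => top_free e1 && top_free e2
  | Bot e1 | Star e1 => top_free e1
  end.

Definition is_parameter {Sigma Pi : Type} (x : expr Sigma Pi) : Prop :=
  (exists2 e, x = Top e & top_free e) \/ (exists p, x = Prp p).

Fixpoint replace_top {Sigma Pi : Type} (e : expr Sigma Pi) : expr Sigma Pi :=
  match e with
  | Act _ | Prp _ | Zero | One => e
  | Add e1 e2 => replace_top e1 + replace_top e2
  | Mul e1 e2 => replace_top e1 * replace_top e2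
  | Bot e1 => Bot (replace_top e1)
  | Top e1 => Bot (Bot (replace_top e1))
  | Star e1 => Star (replace_top e1)
  end%kad.

Definition test_of {Sigma Pi : Type} (e : expr Sigma Pi) : expr Sigma Pi :=
  Top (replace_top e).

Fixpoint subexpr {Sigma Pi : Type} (e : expr Sigma Pi) : set (expr Sigma Pi) :=
  [set e] `|` match e with
              | Act _ | Prp _ | Zero | One => set0
              | Add e1 e2 | Mul e1 e2 => subexpr e1 `|` subexpr e2
              | Bot e1 | Top e1 | Star e1 => subexpr e1
              end.

Definition St {Sigma Pi : Type} (E : set (expr Sigma Pi)) :
    set (expr Sigma Pi) :=
  [set x | exists e f, [/\ E e, subexpr e f, is_formula f & x = test_of f]].

Record FL_closed {Sigma Pi : Type} (G : set (expr Sigma Pi)) : Prop := {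
  FL_parameter : G `<=` is_parameter;
  FL_prp p : G (Top (Prp p)) -> G (Prp p);
  FL_one : G (Top 1);
  FL_zero : G (Top 0);
  FL_add phi psi : is_formula phi -> is_formula psi ->
    G (Top (phi + psi)) -> G (Top phi) /\ G (Top psi);
  FL_mul phi psi : is_formula phi -> is_formula psi ->
    G (Top (phi * psi)) -> G (Top phi) /\ G (Top psi);
  FL_star e : G (Top (Star e)) -> G (Top e);
  FL_mul1 e : (forall f, e <> (f * 1)%kad) -> G (Top e) -> G (Top (e * 1));
  FL_bot e : G (Top (Bot e)) -> G (Top (e * 1));
  FL_addl e f phi : is_formula phi ->
    G (Top ((e + f) * phi)) -> G (Top (e * phi)) /\ G (Top (f * phi));
  FL_mull e f phi : is_formula phi ->
    G (Top ((e * f) * phi)) ->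
    G (Top (f * phi)) /\ G (Top (e * Bot (Bot (f * phi))));
  FL_starl e phi : is_formula phi ->
    G (Top (Star e * phi)) -> G (Top (e * Bot (Bot (Star e * phi)))) }.

Definition FL_closure {Sigma Pi : Type} (S : set (expr Sigma Pi)) :
    set (expr Sigma Pi) :=
  smallest FL_closed S.

(* [s] lists members of [G] and every member of [G] is provably equal to a
   listed one.  Listing up to [===] is essential: the closure rules never
   terminate syntactically once [Top (e * f)] with [f <> 1] is reached: they
   add [Top ((e * f) * 1)] and then [Top (e * Bot (Bot (f * 1)))], which is
   provably equal to [Top (e * f)] but to which the same two rules apply
   again.  A list whose members are exactly those of
   [G] is a special case, see [enumerates_exact]. *)
Definition enumerates {Sigma Pi : Type} (s : seq (expr Sigma Pi))
    (G : set (expr Sigma Pi)) : Prop :=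
  (forall x, List.In x s -> G x) /\
  (forall x, G x -> exists2 y, List.In y s & x === y).

Lemma enumerates_exact {Sigma Pi : Type} (s : seq (expr Sigma Pi))
    (G : set (expr Sigma Pi)) :
  (forall x, List.In x s <-> G x) -> enumerates s G.
Proof.
move=> sG; split=> x; first by move/sG.
by move/sG => xs; exists x => //; exact: keq_refl.
Qed.

Fixpoint prod_expr {Sigma Pi : Type} (s : seq (expr Sigma Pi)) :
    expr Sigma Pi :=
  match s with
  | [::] => One
  | [:: x] => x
  | x :: s' => Mul x (prod_expr s')
  end.

Definition atoms {Sigma Pi : Type} (s : seq (expr Sigma Pi)) :
    set (expr Sigma Pi) :=
  prod_expr @`
    [set t | List.Forall2 (fun phi psi => psi = phi \/ psi = Bot phi) s t].

Definition consistent_atoms {Sigma Pi : Type} (s : seq (expr Sigma Pi)) :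
    set (expr Sigma Pi) :=
  [set G | atoms s G /\ ~ (G === 0)].

(* The string G_1 a_1 G_2 ... a_(n-1) G_n is encoded as
   (G_1, [:: (a_1, G_2); ...; (a_(n-1), G_n)]). *)
Definition gstring (Sigma Pi : Type) : Type :=
  (expr Sigma Pi * seq (Sigma * expr Sigma Pi))%type.

Definition CS {Sigma Pi : Type} (s : seq (expr Sigma Pi)) :
    set (gstring Sigma Pi) :=
  [set w | consistent_atoms s w.1 /\
           forall aG, List.In aG w.2 -> consistent_atoms s aG.2].

Definition glast {Sigma Pi : Type} (w : gstring Sigma Pi) : expr Sigma Pi :=
  last w.1 (map snd w.2).

Definition fusion {Sigma Pi : Type} (L1 L2 : set (gstring Sigma Pi)) :
    set (gstring Sigma Pi) :=
  [set w | exists u v, [/\ L1 u, L2 v, glast u = v.1 & w = (u.1, u.2 ++ v.2)]].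

Definition lang_one {Sigma Pi : Type} (s : seq (expr Sigma Pi)) :
    set (gstring Sigma Pi) :=
  [set (G, [::]) | G in consistent_atoms s].

Fixpoint lang_pow {Sigma Pi : Type} (s : seq (expr Sigma Pi))
    (L : set (gstring Sigma Pi)) (n : nat) : set (gstring Sigma Pi) :=
  if n is n'.+1 then fusion L (lang_pow s L n') else lang_one s.

Fixpoint can_interp {Sigma Pi : Type} (s : seq (expr Sigma Pi))
    (e : expr Sigma Pi) : set (gstring Sigma Pi) :=
  match e with
  | Act a => [set w | CS s w /\
               exists G H, w = (G, [:: (a, H)]) /\ ~ (G * Act a * H === 0)]
  | Prp p => [set (G, [::]) | G in [set G | consistent_atoms s G /\
                                            G <<= Prp p]]
  | Zero => set0
  | One => lang_one s
  | Add e1 e2 => can_interp s e1 `|` can_interp s e2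
  | Mul e1 e2 => fusion (can_interp s e1) (can_interp s e2)
  | Bot e1 => [set (G, [::]) | G in [set G | consistent_atoms s G /\
                 fusion [set (G, [::])] (can_interp s e1) = set0]]
  | Top e1 => [set (G, [::]) | G in [set G | consistent_atoms s G /\
                 fusion [set (G, [::])] (can_interp s e1) <> set0]]
  | Star e1 => \bigcup_n lang_pow s (can_interp s e1) n
  end.

Lemma fusion_CS {Sigma Pi : Type} (s : seq (expr Sigma Pi))
    (L1 L2 : set (gstring Sigma Pi)) :
  L1 `<=` CS s -> L2 `<=` CS s -> fusion L1 L2 `<=` CS s.
Proof.
move=> L1s L2s _ [u [v [/L1s [u1 u2] /L2s [_ v2] _ ->]]]; split=> //= aG.
by move/(List.in_app_or u.2 v.2) => -[/u2|/v2].
Qed.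

Lemma lang_one_CS {Sigma Pi : Type} (s : seq (expr Sigma Pi)) :
  lang_one s `<=` CS s.
Proof. by move=> _ [G Gs <-]; split. Qed.

Lemma can_interp_CS {Sigma Pi : Type} (s : seq (expr Sigma Pi))
    (e : expr Sigma Pi) :
  can_interp s e `<=` CS s.
Proof.
elim: e => //=.
- by move=> a w [].
- by move=> p _ [G [Gs _] <-]; split.
- exact: lang_one_CS.
- by move=> e1 IH1 e2 IH2 w [/IH1|/IH2].
- by move=> e1 IH1 e2 IH2; exact: fusion_CS.
- by move=> e1 _ _ [G [Gs _] <-]; split.
- by move=> e1 _ _ [G [Gs _] <-]; split.
- move=> e1 IH w [n _]; elim: n w => [|n IHn] /=; first exact: lang_one_CS.
  exact: fusion_CS.
Qed.

(* Main.v *)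
(** Soundness for relational models is a direct check.  A language acts on
    guarded strings by fusion on the right, which gives a faithful relational
    representation of the canonical interpretation; hence relational equality
    implies canonical equality, and with soundness so does provable equality.

    For completeness one works in the semiring of expressions modulo [===].
    Given a labelling of guarded strings in a finite monoid [W], the strings
    with fixed end points and fixed label have a sum, a least solution of a
    finite linear system over the Cayley graph of [W]; these sums multiply like
    their labels.  By induction on [e], every expression [e] is the least upper
    bound of the sums of the classes met by its language; the induction needs,
    for antidomain, that an atom starting a string of [e] lies below [Top e],
    which is where Fischer--Ladner closure enters.  If now [W] consists of the
    transition relations of a finite automaton whose states are partial
    derivatives of [e], then every class met by the language of [e] is itself
    below [e].  So if the language of [f] is contained in that of [e], then [f]
    is below [e].

    The Fischer--Ladner closure is finite up to [===] because every test in it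
    is a trivial syntactic variant of one in a finite set of components. *)

Require Import Defs.
From mathcomp Require Import all_boot.
From mathcomp Require Import boolp classical_sets cardinality.
From HB Require Import structures.
From mathcomp Require Import ssralg.
Import GRing.Theory.

Set Implicit Arguments.
Unset Strict Implicit.
Unset Printing Implicit Defensive.

HB.instance Definition _ (Sigma Pi : Type) := gen_eqMixin (expr Sigma Pi).
HB.instance Definition _ (Sigma Pi : Type) := gen_choiceMixin (expr Sigma Pi).

(** * The idempotent semiring of expressions modulo [===] *)

Section Quotient.
Variables Sigma Pi : Type.
Implicit Types e f g : expr Sigma Pi.

Definition keqb e f : bool := `[< e === f >].

Lemma keqb_refl : reflexive keqb.
Proof. by move=> e; apply/asboolP; exact: keq_refl. Qed.

Lemma keqb_sym : symmetric keqb.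
Proof. by move=> e f; apply/asboolP/asboolP; exact: keq_sym. Qed.

Lemma keqb_trans : transitive keqb.
Proof.
by move=> f e g /asboolP ef /asboolP fg; apply/asboolP; exact: keq_trans ef fg.
Qed.

Canonical keqb_equiv := EquivRel keqb keqb_refl keqb_sym keqb_trans.

Definition kad := {eq_quot keqb_equiv}%qT.
HB.instance Definition _ := Choice.on kad.
HB.instance Definition _ := EqQuotient.on kad.

Definition cls e : kad := (\pi_(kad) e)%qT.

Lemma clsP e f : cls e = cls f <-> e === f.
Proof.
split; first by move/eqmodP/asboolP.
by move=> ef; apply/eqmodP/asboolP.
Qed.

Lemma cls_repr (x : kad) : cls (repr x) = x.
Proof. exact: reprK. Qed.

Lemma repr_cls e : repr (cls e) === e.
Proof. by apply/clsP; rewrite cls_repr. Qed.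

Definition kadd (x y : kad) := cls (repr x + repr y).
Definition kmul (x y : kad) := cls (repr x * repr y).
Definition kstar (x : kad) := cls (Star (repr x)).
Definition kbot (x : kad) := cls (Bot (repr x)).

Lemma kaddE e f : kadd (cls e) (cls f) = cls (e + f).
Proof. by apply/clsP/keq_add; exact: repr_cls. Qed.

Lemma kmulE e f : kmul (cls e) (cls f) = cls (e * f).
Proof. by apply/clsP/keq_mul; exact: repr_cls. Qed.

Lemma kad_ind (P : kad -> Prop) : (forall e, P (cls e)) -> forall x, P x.
Proof. by move=> Pcls x; rewrite -(cls_repr x). Qed.

Lemma kaddA : associative kadd.
Proof.
by do 3![elim/kad_ind=> ?]; rewrite !kaddE; apply/clsP; exact: keq_addA.
Qed.

Lemma kaddC : commutative kadd.
Proof.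
by do 2![elim/kad_ind=> ?]; rewrite !kaddE; apply/clsP; exact: keq_addC.
Qed.

Lemma kadd0 : left_id (cls 0) kadd.
Proof.
elim/kad_ind=> e; rewrite kaddC kaddE; apply/clsP; exact: keq_add0.
Qed.

Lemma kmulA : associative kmul.
Proof.
by do 3![elim/kad_ind=> ?]; rewrite !kmulE; apply/clsP; exact: keq_mulA.
Qed.

Lemma kmul1l : left_id (cls 1) kmul.
Proof. by elim/kad_ind=> e; rewrite kmulE; apply/clsP; exact: keq_mul1l. Qed.

Lemma kmul1r : right_id (cls 1) kmul.
Proof. by elim/kad_ind=> e; rewrite kmulE; apply/clsP; exact: keq_mul1r. Qed.

Lemma kmul0l : left_zero (cls 0) kmul.
Proof. by elim/kad_ind=> e; rewrite kmulE; apply/clsP; exact: keq_mul0l. Qed.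

Lemma kmul0r : right_zero (cls 0) kmul.
Proof. by elim/kad_ind=> e; rewrite kmulE; apply/clsP; exact: keq_mul0r. Qed.

Lemma kmulDl : left_distributive kmul kadd.
Proof.
by do 3![elim/kad_ind=> ?]; rewrite !(kaddE, kmulE); apply/clsP/keq_mulDl.
Qed.

Lemma kmulDr : right_distributive kmul kadd.
Proof.
by do 3![elim/kad_ind=> ?]; rewrite !(kaddE, kmulE); apply/clsP/keq_mulDr.
Qed.

HB.instance Definition _ := GRing.isNmodule.Build kad kaddA kaddC kadd0.
HB.instance Definition _ := GRing.Nmodule_isPzSemiRing.Build kad
  kmulA kmul1l kmul1r kmulDl kmulDr kmul0l kmul0r.

Local Open Scope ring_scope.
Implicit Types x y z : kad.

Lemma cls0 : cls 0%kad = 0. Proof. by []. Qed.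
Lemma cls1 : cls 1%kad = 1. Proof. by []. Qed.
Lemma clsD e f : cls (e + f)%kad = cls e + cls f.
Proof. by rewrite -kaddE. Qed.
Lemma clsM e f : cls (e * f)%kad = cls e * cls f.
Proof. by rewrite -kmulE. Qed.
Lemma clsS e : cls (Star e) = kstar (cls e).
Proof. by apply/clsP/keq_star/keq_sym/repr_cls. Qed.
Lemma clsB e : cls (Bot e) = kbot (cls e).
Proof. by apply/clsP/keq_bot/keq_sym/repr_cls. Qed.
Lemma clsT e : cls (Top e) = kbot (kbot (cls e)).
Proof. by rewrite -!clsB; apply/clsP/keq_top_botbot. Qed.

(** * The natural order and star induction *)

Definition kle x y := x + y = y.
Local Infix "≤" := kle (at level 70).

Lemma kaddxx x : x + x = x.
Proof. by elim/kad_ind: x => e; rewrite -clsD; apply/clsP/keq_addI. Qed.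

Lemma kle_refl x : x ≤ x. Proof. exact: kaddxx. Qed.
Hint Resolve kle_refl : core.

Lemma kle_trans y x z : x ≤ y -> y ≤ z -> x ≤ z.
Proof. by rewrite /kle => xy <-; rewrite addrA xy. Qed.

Lemma kle_anti x y : x ≤ y -> y ≤ x -> x = y.
Proof. by rewrite /kle => xy yx; rewrite -yx addrC. Qed.

Lemma kle0 x : 0 ≤ x. Proof. exact: add0r. Qed.
Hint Resolve kle0 : core.

Lemma kle_eq0 x : x ≤ 0 -> x = 0.
Proof. by move=> x0; exact: kle_anti. Qed.

Lemma kle_addl x y : x ≤ x + y.
Proof. by rewrite /kle addrA kaddxx. Qed.

Lemma kle_addr x y : y ≤ x + y.
Proof. by rewrite addrC; exact: kle_addl. Qed.

Lemma kadd_le x y z : x ≤ z -> y ≤ z -> x + y ≤ z.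
Proof. by rewrite /kle -addrA => xz ->. Qed.

Lemma kle_mul x x' y y' : x ≤ x' -> y ≤ y' -> x * y ≤ x' * y'.
Proof.
move=> xx yy; apply: (@kle_trans (x * y')).
  by rewrite /kle -mulrDr yy.
by rewrite /kle -mulrDl xx.
Qed.

Lemma kle_mulr x x' y : x ≤ x' -> x * y ≤ x' * y.
Proof. by move=> xx; exact: kle_mul. Qed.

Lemma kle_mull x y y' : y ≤ y' -> x * y ≤ x * y'.
Proof. by move=> yy; exact: kle_mul. Qed.

Lemma kle_mul1r x y : x ≤ 1 -> x * y ≤ y.
Proof. by move=> x1; rewrite -[X in _ ≤ X]mul1r; exact: kle_mulr. Qed.

Lemma kle_mul1l x y : x ≤ 1 -> y * x ≤ y.
Proof. by move=> x1; rewrite -[X in _ ≤ X]mulr1; exact: kle_mull. Qed.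

Lemma kstar_unfoldl x : 1 + x * kstar x ≤ kstar x.
Proof.
elim/kad_ind: x => e; have /clsP := keq_star_unfoldl e.
by rewrite !(clsD, clsM, clsS).
Qed.

Lemma kstar1 x : 1 ≤ kstar x.
Proof. exact: kle_trans (kle_addl _ _) (kstar_unfoldl x). Qed.

Lemma kstarM x : x * kstar x ≤ kstar x.
Proof. exact: kle_trans (kle_addr _ _) (kstar_unfoldl x). Qed.

Lemma kstar_ind x y z : y ≤ z -> x * z ≤ z -> kstar x * y ≤ z.
Proof.
move=> yz xz; have := kadd_le yz xz.
elim/kad_ind: x xz => e _; elim/kad_ind: y yz => f _.
elim/kad_ind: z => g efg; have /keq_star_indl/clsP : f + e * g <<= g.
  by apply/clsP; rewrite !(clsD, clsM).
by rewrite !(clsD, clsM, clsS).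
Qed.

(** * Antidomain elements and complemented elements *)

Lemma kbot_mul x : kbot x * x = 0.
Proof.
by elim/kad_ind: x => e; have /clsP := keq_bot_mul e; rewrite clsM clsB.
Qed.

Lemma kbot_add x : kbot x + kbot (kbot x) = 1.
Proof.
by elim/kad_ind: x => e; have /clsP := keq_bot_top e; rewrite clsD clsT clsB.
Qed.

Lemma kbot_local x y : kbot (x * y) = kbot (x * kbot (kbot y)).
Proof.
elim/kad_ind: x => e; elim/kad_ind: y => f.
by have /clsP := keq_bot_local e f; rewrite !(clsB, clsM, clsT).
Qed.

Lemma kbot1 : kbot 1 = 0 :> kad.
Proof. by rewrite -[LHS]mulr1 kbot_mul. Qed.

Lemma kbot0 : kbot 0 = 1 :> kad.
Proof. by rewrite -(kbot_add 1) kbot1 add0r. Qed.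

Lemma kbot_triple x : kbot (kbot (kbot x)) = kbot x.
Proof. by rewrite -[in RHS](mul1r x) kbot_local mul1r. Qed.

Lemma kbot_eq1 x : kbot x = 1 -> x = 0.
Proof. by move=> x1; rewrite -[x]mul1r -x1 kbot_mul. Qed.

(** By locality, replacing [y] by its domain keeps the antidomain of the product, and only 0 has
    antidomain 1. *)
Lemma kmul_dom0 x y : x * y = 0 -> x * kbot (kbot y) = 0.
Proof. by move=> xy; apply: kbot_eq1; rewrite -kbot_local xy kbot0. Qed.

(** Such elements form a Boolean algebra below 1 under the semiring operations, so all formulas can
    be treated alike, sums and products included. *)
Definition complemented x := exists y, [/\ x + y = 1, x * y = 0 & y * x = 0].

Lemma compl_le1 x : complemented x -> x ≤ 1.
Proof. by case=> y [<- _ _]; exact: kle_addl. Qed.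

Lemma compl_idem x : complemented x -> x * x = x.
Proof.
by case=> y [xy1 xy _]; rewrite -[RHS]mulr1 -xy1 mulrDr xy addr0.
Qed.

(** With [y] below 1, [x * y * x'] lies below [x * x' = 0], so [x * y = x * y * x]; symmetrically
    [y * x = x * y * x]. *)
Lemma complC x y : complemented x -> complemented y -> x * y = y * x.
Proof.
move=> cx /compl_le1 y1; case: (cx) => x' [x1 xx' x'x].
have e1 : x * y = x * y * x.
  rewrite -[LHS]mulr1 -x1 mulrDr.
  suff -> : x * y * x' = 0 by rewrite addr0.
  by apply: kle_eq0; rewrite -xx'; apply: kle_mulr; exact: kle_mul1l.
rewrite e1 -[RHS]mul1r -x1 mulrDl.
suff -> : x' * (y * x) = 0 by rewrite addr0 mulrA.
by apply: kle_eq0; rewrite -x'x; apply: kle_mull; exact: kle_mul1r.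
Qed.

Lemma compl1 : complemented 1.
Proof. by exists 0; rewrite addr0 mulr0 mul0r. Qed.

Lemma compl0 : complemented 0.
Proof. by exists 1; rewrite add0r mulr0 mul0r. Qed.

Lemma complM x y : complemented x -> complemented y -> complemented (x * y).
Proof.
move=> cx cy; case: (cx) => x' [x1 xx' x'x]; case: (cy) => y' [y1 yy' y'y].
exists (x' + x * y'); split.
- rewrite [x' + _]addrC addrA -mulrDr y1 mulr1 //.
- rewrite mulrDr {1}(complC cx cy) -mulrA xx' mulr0 add0r.
  by rewrite (complC cx cy) -mulrA [x * (x * _)]mulrA compl_idem // (mulrA y)
    -(complC cx cy) -mulrA yy' mulr0.
- rewrite mulrDl mulrA x'x mul0r add0r (complC cx cy) -mulrA [y' * (_ * _)]mulrA.
  by rewrite y'y mul0r mulr0.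
Qed.

Lemma complN x y : x + y = 1 -> x * y = 0 -> y * x = 0 -> complemented y.
Proof. by exists x; rewrite addrC. Qed.

Lemma complD x y : complemented x -> complemented y -> complemented (x + y).
Proof.
move=> cx cy; case: (cx) => x' [x1 xx' x'x]; case: (cy) => y' [y1 yy' y'y].
have cx' : complemented x' by exact: (complN x1).
have cy' : complemented y' by exact: (complN y1).
exists (x' * y'); split.
- apply: kle_anti.
    apply: kadd_le; first by apply: kadd_le; exact: compl_le1.
    exact/compl_le1/complM.
  rewrite -{1}x1; apply: kadd_le; first by rewrite -addrA; exact: kle_addl.
  rewrite -[x' in x' ≤ _]mulr1 -y1 mulrDr; apply: kadd_le; last exact: kle_addr.
  apply: kle_trans (kle_addl _ _); apply: kle_trans (kle_addr _ _).
  exact/kle_mul1r/compl_le1.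
- by rewrite mulrDl mulrA xx' mul0r (complC cx' cy') mulrA yy' mul0r addr0.
- rewrite mulrDr -[x' * y' * y]mulrA y'y mulr0 addr0 (complC cx' cy').
  by rewrite -mulrA x'x mulr0.
Qed.

Lemma compl_bot x : complemented (kbot x).
Proof.
exists (kbot (kbot x)); split; [exact: kbot_add| |exact: kbot_mul].
exact/kmul_dom0/kbot_mul.
Qed.

(** [kbot y] commutes with [x], so [x * kbot y] lies below [kbot y * y = 0], and all of [x] falls
    under the domain of [y]. *)
Lemma compl_dom_le x y : complemented x -> x ≤ y -> x ≤ kbot (kbot y).
Proof.
move=> cx xy.
have x0 : x * kbot y = 0.
  rewrite (complC cx (compl_bot y)); apply: kle_eq0.
  by rewrite -(kbot_mul y); exact: kle_mull.
rewrite -[x in x ≤ _]mulr1 -(kbot_add y) mulrDr x0 add0r.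
exact/kle_mul1r/compl_le1.
Qed.

Lemma kdom_mono x y : x ≤ y -> kbot (kbot x) ≤ kbot (kbot y).
Proof.
move=> xy; have y0 : kbot y * kbot (kbot x) = 0.
  apply: kmul_dom0; apply: kle_eq0; rewrite -(kbot_mul y); exact: kle_mull.
rewrite -[X in X ≤ _]mul1r -(kbot_add y) mulrDl y0 add0r.
exact/kle_mul1l/compl_le1/compl_bot.
Qed.

Lemma compl_mul0_bot x y : complemented x -> x * y = 0 -> x ≤ kbot y.
Proof.
move=> cx /kmul_dom0 xy0.
rewrite -[x in x ≤ _]mulr1 -(kbot_add y) mulrDr xy0 addr0.
exact/kle_mul1r/compl_le1.
Qed.

(** * Finite suprema and least solutions of linear systems *)

Definition fsup (T : Type) (l : seq T) (P : T -> Prop) (F : T -> kad) : kad :=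
  \sum_(t <- l | `[< P t >]) F t.

Lemma fsup_ub (T : Type) (l : seq T) (P : T -> Prop) (F : T -> kad) t :
  List.In t l -> P t -> F t ≤ fsup l P F.
Proof.
rewrite /fsup; elim: l => //= t' l IHl [<-|tl] Pt; rewrite big_cons.
  by rewrite asboolT //; exact: kle_addl.
case: ifP => _; last exact: IHl.
by apply: kle_trans (kle_addr _ _); exact: IHl.
Qed.

Lemma fsup_le (T : Type) (l : seq T) (P : T -> Prop) (F : T -> kad) c d z :
  (forall t, List.In t l -> P t -> c * F t * d ≤ z) -> c * fsup l P F * d ≤ z.
Proof.
rewrite /fsup; elim: l => [|t l IHl] Fz.
  by rewrite big_nil mulr0 mul0r.
rewrite big_cons.
have lz : c * (\sum_(i <- l | `[< P i >]) F i) * d ≤ z.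
  by apply: IHl => i il; apply: Fz; right.
case: ifP => [/asboolP Pt|//]; rewrite mulrDr mulrDl; apply: kadd_le => //.
by apply: Fz => //; left.
Qed.

Lemma fsup_le_right (T : Type) (l : seq T) (P : T -> Prop) (F : T -> kad) d z :
  (forall t, List.In t l -> P t -> F t * d ≤ z) -> fsup l P F * d ≤ z.
Proof.
move=> Fz; rewrite -[fsup _ _ _]mul1r; apply: fsup_le => t.
by rewrite mul1r; exact: Fz.
Qed.

(** The factor [c] builds right multiplication into minimality, as in star induction, so that bounds
    on products [x i * c] follow directly. *)
Definition least_solution (T : Type) (l : seq T) (M : T -> T -> kad)
    (b x : T -> kad) : Prop :=
  [/\ forall i, List.In i l -> b i ≤ x i,
      forall i j, List.In i l -> List.In j l -> M i j * x j ≤ x i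
    & forall (y : T -> kad) c, (forall i, List.In i l -> b i * c ≤ y i) ->
        (forall i j, List.In i l -> List.In j l -> M i j * y j ≤ y i) ->
        forall i, List.In i l -> x i * c ≤ y i].

(* Gaussian elimination: the unknown [v] is solved by [(M v v)^* (b v + ...)]
   and substituted into the other equations. *)
Lemma least_solution_exists (T : Type) (l : seq T) (M : T -> T -> kad)
    (b : T -> kad) : exists x : T -> kad, least_solution l M b x.
Proof.
elim: l M b => [|v l IHl] M b; first by exists b; split.
(* A repeated unknown adds no new equation, so the solution for the tail already serves. *)
have [vl|vl] := pselect (List.In v l).
  have [x [x1 x2 x3]] := IHl M b; exists x.
  have sub i : List.In i (v :: l) -> List.In i l by case=> [<-|].
  split=> [i /sub|i j /sub il /sub jl|y c y1 y2 i /sub]; [exact: x1|exact: x2|].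
  by apply: x3 => [j jl|j k jl kl]; [apply: y1|apply: y2]; right.
set s := kstar (M v v).
(* Each coefficient is increased by the detours through [v], which may loop there any number of
   times. *)
have [x [x1 x2 x3]] := IHl (fun i j => M i j + M i v * (s * M v j))
                           (fun i => b i + M i v * (s * b v)).
pose xv := s * (b v + fsup l (fun _ => True) (fun j => M v j * x j)).
pose x' i := if `[< i = v >] then xv else x i.
have x'v : x' v = xv by rewrite /x' asboolT.
have x'l i : List.In i l -> x' i = x i.
  by move=> il; rewrite /x' asboolF // => iv; apply: vl; rewrite -iv.
have sM z : s * z + M v v * (s * z) ≤ s * z.
  apply: kadd_le => //; rewrite mulrA; apply: kle_mulr; exact: kstarM.
have s1 z : z ≤ s * z by rewrite -[X in X ≤ _]mul1r; apply/kle_mulr/kstar1.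
have bv : b v ≤ xv.
  by apply: kle_trans (s1 _) _; apply: kle_mull; exact: kle_addl.
have Mvj j : List.In j l -> M v j * x j ≤ xv.
  move=> jl; apply: kle_trans (s1 _) _; apply/kle_mull.
  apply: kle_trans (kle_addr _ _).
  exact: (@fsup_ub _ _ (fun=> True) (fun j => M v j * x j)).
have Mvv : M v v * xv ≤ xv.
  by apply: kle_trans (sM _); exact: kle_addr.
have Miv i : List.In i l -> M i v * xv ≤ x i.
  move=> il; rewrite /xv mulrA mulrDr; apply: kadd_le.
    by apply: kle_trans (x1 i il); rewrite -mulrA; exact: kle_addr.
  rewrite -[_ * fsup _ _ _]mulr1; apply: fsup_le => j jl _; rewrite mulr1.
  apply: kle_trans (x2 i j il jl); rewrite mulrDl.
  by apply: kle_trans (kle_addr _ _); rewrite !mulrA.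
exists x'; split.
- move=> i [<-|il]; first by rewrite x'v.
  by rewrite x'l //; apply: kle_trans (x1 i il); exact: kle_addl.
- move=> i j [<-|il] [<-|jl]; rewrite ?x'v ?x'l //; [exact: Mvj|exact: Miv|].
  apply: kle_trans (x2 i j il jl); apply: kle_mulr; exact: kle_addl.
- move=> y c y1 y2.
  (* Star induction absorbs the loop at [v]; hence [y] also satisfies the reduced system. *)
  have yv z : z ≤ y v -> s * z ≤ y v.
    by move=> zy; apply: kstar_ind => //; apply: y2; left.
  have y3 i : List.In i l -> x i * c ≤ y i.
    apply: x3 => {}i.
      move=> il; rewrite mulrDl; apply: kadd_le; first by apply: y1; right.
      rewrite -!mulrA; apply: kle_trans (y2 i v _ _); try by [left|right].
      by apply/kle_mull/yv/y1; left.
    move=> j il jl; rewrite mulrDl; apply: kadd_le; first by apply: y2; right.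
    rewrite -!mulrA; apply: kle_trans (y2 i v _ _); try by [left|right].
    by apply/kle_mull/yv/y2; [left|right].
  move=> i [<-|il]; last by rewrite x'l //; exact: y3.
  rewrite x'v /xv -mulrA; apply: yv; rewrite mulrDl; apply: kadd_le.
    by apply: y1; left.
  apply: fsup_le_right => j jl _; rewrite -mulrA.
  apply: kle_trans (y2 v j _ _); try by [left|right].
  by apply/kle_mull/y3.
Qed.

End Quotient.

Local Infix "≤" := kle (at level 70).
#[local] Hint Resolve kle_refl kle0 : core.

(** * Atoms *)

Section Atoms.
Variables Sigma Pi : Type.
Local Open Scope ring_scope.
Implicit Types (e f g G H : expr Sigma Pi) (s t : seq (expr Sigma Pi)).

Lemma parameter_bot e : is_parameter e -> exists x, cls e = kbot x.
Proof.
case=> [[f -> _]|[p ->]]; first by exists (kbot (cls f)); rewrite clsT.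
exists (kbot (cls (Prp p))); rewrite -clsT; apply/clsP/keq_sym.
exact: keq_top_prp.
Qed.

Lemma formula_compl e : is_formula e -> complemented (cls e).
Proof.
elim: e => //=.
- move=> p _; have [|x ->] := @parameter_bot (Prp p); last exact: compl_bot.
  by right; exists p.
- by move=> _; exact: compl0.
- by move=> _; exact: compl1.
- by move=> e IHe f IHf /andP[/IHe ? /IHf ?]; rewrite clsD; exact: complD.
- by move=> e IHe f IHf /andP[/IHe ? /IHf ?]; rewrite clsM; exact: complM.
- by move=> e _ _; rewrite clsB; exact: compl_bot.
- by move=> e _ _; rewrite clsT; exact: compl_bot.
Qed.

Definition parameters s := forall e, List.In e s -> is_parameter e.

Definition choice_of s t :=
  List.Forall2 (fun phi psi => psi = phi \/ psi = Bot phi) s t.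

Lemma parameters_cons e s :
  parameters (e :: s) -> is_parameter e /\ parameters s.
Proof. by move=> es; split=> [|f fs]; apply: es; [left|right]. Qed.

Lemma cls_prod_cons e t :
  cls (prod_expr (e :: t)) = cls e * cls (prod_expr t).
Proof. by case: t => [|f t] /=; rewrite ?clsM ?mulr1. Qed.

Lemma choice_compl s t :
  parameters s -> choice_of s t -> complemented (cls (prod_expr t)).
Proof.
move=> + st; elim: st => [_|e h s' t' eh st IH /parameters_cons[pe ps]].
  exact: compl1.
rewrite cls_prod_cons; apply: complM; last exact: IH.
have [x ex] := parameter_bot pe.
by case: eh => ->; rewrite ?clsB ?ex; exact: compl_bot.
Qed.

Lemma choice_decide s t e : parameters s -> choice_of s t -> List.In e s ->
  cls (prod_expr t) ≤ cls e \/ cls (prod_expr t) ≤ kbot (cls e).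
Proof.
move=> + st; elim: st => // f h s' t' fh st IH /parameters_cons[pf ps] /= es.
have ct := choice_compl ps st.
have [x fx] := parameter_bot pf.
have ch : complemented (cls h).
  by case: fh => ->; rewrite ?clsB ?fx; exact: compl_bot.
rewrite cls_prod_cons; case: es => [<-|es].
  by case: fh => ->; [left|right]; rewrite ?clsB; exact/kle_mul1l/compl_le1.
have le := kle_mul1r (cls (prod_expr t')) (compl_le1 ch).
by have [te|te] := IH ps es; [left|right]; exact: kle_trans te.
Qed.

(** Where the choices differ, one has [e] and the other [Bot e]; these annihilate each other, and
    the remaining factors only shrink the product. *)
Lemma choice_disjoint s t t' :
  parameters s -> choice_of s t -> choice_of s t' ->
  t = t' \/ cls (prod_expr t) * cls (prod_expr t') = 0.
Proof.
move=> + st; elim: st t' => [|e h s' u eh su IH] t' ps st'.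
  by inversion st'; left.
inversion st' as [|? h' ? u' eh' su']; subst.
have [pe ps'] := parameters_cons ps.
have cu := choice_compl ps' su; have cu' := choice_compl ps' su'.
have [x ex] := parameter_bot pe.
have ch : complemented (cls h).
  by case: eh => ->; rewrite ?clsB ?ex; exact: compl_bot.
have ch' : complemented (cls h').
  by case: eh' => ->; rewrite ?clsB ?ex; exact: compl_bot.
have [hh|hh] : h = h' \/ cls h * cls h' = 0.
  have eC : cls e * kbot (cls e) = 0 :> kad _ _.
    rewrite (complC _ (compl_bot _)) ?kbot_mul //.
    by rewrite ex; exact: compl_bot.
  case: eh => ->; case: eh' => ->; rewrite ?clsB ?eC ?kbot_mul;
    by [left|right].
- have [uu|uu] := IH u' ps' su'; first by left; rewrite hh uu.
  right; apply: kle_eq0; rewrite -uu !cls_prod_cons.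
  by apply: kle_mul; apply: kle_mul1r; exact: compl_le1.
- right; apply: kle_eq0; rewrite -hh !cls_prod_cons.
  by apply: kle_mul; apply: kle_mul1l; exact: compl_le1.
Qed.

(** The atoms sum to 1, stated in a context: [1] is expanded as [Bot e + e] for each parameter [e]
    in turn. *)
Lemma choice_cover s c d z : parameters s ->
  (forall t, choice_of s t -> c * cls (prod_expr t) * d ≤ z) -> c * d ≤ z.
Proof.
elim: s c => [|e s IH] c ps cz; first by rewrite -[c]mulr1; exact: (cz [::]).
have [pe ps'] := parameters_cons ps.
rewrite -[c]mulr1 -(kbot_add (cls e)).
have [x ex] := parameter_bot pe.
have -> : kbot (kbot (cls e)) = cls e by rewrite ex kbot_triple.
rewrite mulrDr mulrDl; apply: kadd_le; apply: IH => // t st.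
  have := cz (Bot e :: t) (List.Forall2_cons _ _ (or_intror erefl) st).
  by rewrite cls_prod_cons clsB !mulrA.
have := cz (e :: t) (List.Forall2_cons _ _ (or_introl erefl) st).
by rewrite cls_prod_cons !mulrA.
Qed.

Lemma choices_listed s :
  exists l : seq (seq (expr Sigma Pi)), forall t, choice_of s t -> List.In t l.
Proof.
elim: s => [|e s [l IH]].
  by exists [:: [::]] => t st; inversion st; left.
exists (List.map (cons e) l ++ List.map (cons (Bot e)) l) => t st.
inversion st as [|? h ? u eh su]; subst; apply/List.in_or_app.
by case: eh => ->; [left|right]; apply: List.in_map; exact: IH.
Qed.

Lemma atoms_listed s :
  exists l : seq (expr Sigma Pi), forall G, atoms s G -> List.In G l.
Proof.
have [l sl] := choices_listed s; exists (List.map prod_expr l) => _ [t st <-].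
by apply: List.in_map; exact: sl.
Qed.

End Atoms.

(** * Classes of guarded strings *)

Lemma In_mem (T : eqType) (x : T) (l : seq T) : List.In x l <-> x \in l.
Proof.
elim: l => //= y l IH; rewrite inE; split.
  by case=> [->|/IH ->]; rewrite ?eqxx ?orbT.
by case/predU1P => [->|/IH]; [left|right].
Qed.

Lemma starts_with (Sigma Pi : Type) (G : expr Sigma Pi)
    (L : set (gstring Sigma Pi)) :
  fusion [set (G, [::])] L <> set0 <-> exists2 w, L w & w.1 = G.
Proof.
split=> [/eqP/set0P [_ [_ [v [-> Lv Gv _]]]]|[w Lw wG]].
  by exists v; rewrite -?Gv.
by apply/eqP/set0P; exists w, (G, [::]), w; split; rewrite // -wG; case: (w).
Qed.

Fixpoint acts_in (Sigma Pi : Type) (acts : seq Sigma) (e : expr Sigma Pi) : Prop :=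
  match e with
  | Act a => List.In a acts
  | Prp _ | Zero | One => True
  | Add e1 e2 | Mul e1 e2 => acts_in acts e1 /\ acts_in acts e2
  | Bot e1 | Top e1 | Star e1 => acts_in acts e1
  end.

(* The fragment of the Fischer--Ladner conditions on [e] under which the
   canonical interpretation of [e] is faithful. *)
Fixpoint tests_in (Sigma Pi : Type) (Gamma : set (expr Sigma Pi))
    (e : expr Sigma Pi) : Prop :=
  match e with
  | Act _ | Zero | One => True
  | Prp p => Gamma (Prp p)
  | Add e1 e2 | Mul e1 e2 => tests_in Gamma e1 /\ tests_in Gamma e2
  | Bot e1 => Gamma (Top (e1 * 1)) /\ tests_in Gamma e1
  | Top _ => False
  | Star e1 => tests_in Gamma e1
  end.

Section Strings.
Variables (Sigma Pi : Type) (s : seq (expr Sigma Pi)).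
Hypothesis ps : parameters s.
Local Open Scope classical_set_scope.
Local Open Scope ring_scope.
Implicit Types (e f g G H : expr Sigma Pi) (w : gstring Sigma Pi).

Lemma atom_compl G : atoms s G -> complemented (cls G).
Proof. by case=> t st <-; exact: choice_compl st. Qed.

Lemma atom_le1 G : atoms s G -> cls G ≤ 1.
Proof. by move=> /atom_compl/compl_le1. Qed.

Lemma atom_idem G : atoms s G -> cls G * cls G = cls G.
Proof. by move=> /atom_compl/compl_idem. Qed.

Lemma atom_disjoint G H :
  atoms s G -> atoms s H -> G <> H -> cls G * cls H = 0.
Proof.
move=> [t st <-] [t' st' <-] neq.
by have [tt|//] := choice_disjoint ps st st'; rewrite tt in neq.
Qed.

(** Inconsistent atoms are 0 in the quotient, so the consistent ones alone still sum to 1. *)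
Lemma atoms_cover c d z :
  (forall G, consistent_atoms s G -> c * cls G * d ≤ z) -> c * d ≤ z.
Proof.
move=> cz; apply: choice_cover (ps) _ => t st.
have [t0|t0] := pselect (prod_expr t === 0%kad).
  by rewrite (iffRL (clsP _ _) t0) cls0 mulr0 mul0r.
by apply: cz; split=> //; exists t.
Qed.

Lemma glast_atom w : CS s w -> consistent_atoms s (glast w).
Proof.
case: w => G l [/= cG cl]; rewrite /glast /=.
elim: l G cG cl => //= -[a H] l IH G cG cl; apply: IH; last first.
  by move=> aG aGl; apply: cl; right.
by apply: (cl (a, H)); left.
Qed.

Lemma fusion_inP (L L' : set (gstring Sigma Pi)) u v :
  L u -> L' v -> glast u = v.1 -> fusion L L' (u.1, u.2 ++ v.2).
Proof. by move=> Lu Lv uv; exists u, v. Qed.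

Lemma glast_cat G (l l' : seq (Sigma * expr Sigma Pi)) :
  glast (G, l ++ l') = glast (glast (G, l), l').
Proof. by rewrite /glast /= map_cat last_cat. Qed.

(** * Sums of guarded strings with given end points and label *)

Section Paths.
Variables (W : finType) (one : W) (mul : Monoid.law one).
Variables (lam : expr Sigma Pi -> Sigma -> expr Sigma Pi -> W).
Variable acts : seq Sigma.

Let V := (expr Sigma Pi * W)%type.

Definition atom_list := sval (cid (atoms_listed s)).

Lemma atom_listP G : atoms s G -> List.In G atom_list.
Proof. exact: (svalP (cid (atoms_listed s))). Qed.

Definition vertices : seq V := List.filter (fun v => `[< atoms s v.1 >])
  (List.list_prod atom_list (enum W)).

Lemma verticesP (v : V) : List.In v vertices <-> atoms s v.1.
Proof.
rewrite /vertices List.filter_In; split=> [[_ /asboolP //]|sv].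
split; last exact/asboolP.
case: v sv => G S sG; apply/List.in_prod; first exact: atom_listP.
by apply/In_mem; rewrite mem_enum.
Qed.

(** The second component of a vertex is the label of the prefix read so far, so a letter multiplies
    it on the right. *)
Definition edge (v v' : V) : kad Sigma Pi :=
  fsup acts (fun a => mul v.2 (lam v.1 a v'.1) = v'.2)
    (fun a => cls (v.1 * Act a * v'.1)%kad).

Definition target (t v : V) : kad Sigma Pi :=
  if `[< v = t >] then cls t.1 else 0.

(* [pth t v] is the sum of all strings that lead from [v] to [t] in the graph
   of right translations of [W]. *)
Definition pth (t : V) : V -> kad Sigma Pi :=
  sval (cid (least_solution_exists vertices edge (target t))).

Lemma pthP t : least_solution vertices edge (target t) (pth t).
Proof. exact: (svalP (cid (least_solution_exists _ _ _))). Qed.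

Lemma pth_refl t : atoms s t.1 -> cls t.1 ≤ pth t t.
Proof.
move=> ts; have [+ _ _] := pthP t; move/(_ t (iffRL (verticesP t) ts)).
by rewrite /target asboolT.
Qed.

Lemma pth_step t G S a G' : atoms s G -> atoms s G' -> List.In a acts ->
  cls (G * Act a * G')%kad * pth t (G', mul S (lam G a G')) ≤ pth t (G, S).
Proof.
move=> sG sG' aa; have [_ + _] := pthP t.
move/(_ (G, S) (G', mul S (lam G a G')) (iffRL (verticesP (G, S)) sG)
  (iffRL (verticesP (G', _)) sG')).
apply: kle_trans; apply: kle_mulr.
exact: (@fsup_ub _ _ _ _ (fun a' => mul S (lam G a' G') = _)
         (fun a' => cls (G * Act a' * G')%kad)).
Qed.

(** Path induction backwards from the target, with a factor [c] for what follows it. *)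
Lemma pth_least t (y : V -> kad Sigma Pi) c : atoms s t.1 -> cls t.1 * c ≤ y t ->
  (forall G S a G', atoms s G -> atoms s G' -> List.In a acts ->
    cls (G * Act a * G')%kad * y (G', mul S (lam G a G')) ≤ y (G, S)) ->
  forall v, atoms s v.1 -> pth t v * c ≤ y v.
Proof.
move=> ts yt yS v vs; have [_ _ +] := pthP t.
apply; last exact/verticesP.
  move=> i _; rewrite /target; case: ifPn => [/asboolP -> //|_].
  by rewrite mul0r.
move=> [G S] [G' S'] /verticesP iV /verticesP jV.
by apply: fsup_le_right => a aa /= <-; exact: yS.
Qed.

Definition strsum G (R : W) H := pth (H, R) (G, one).

Lemma strsum_refl G : atoms s G -> cls G ≤ strsum G one G.
Proof. exact: (@pth_refl (G, one)). Qed.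

Lemma strsum_letter G a H : atoms s G -> atoms s H -> List.In a acts ->
  cls (G * Act a * H)%kad ≤ strsum G (lam G a H) H.
Proof.
move=> sG sH aa; apply: kle_trans (pth_step _ _ sG sH aa).
rewrite Monoid.mul1m; apply: (@kle_trans _ _ (cls (G * Act a * H)%kad * cls H)).
  by rewrite [cls (_ * H)%kad]clsM -mulrA atom_idem.
exact/kle_mull/(@pth_refl (H, _)).
Qed.

Lemma strsum_target G R H : atoms s G -> atoms s H ->
  strsum G R H ≤ strsum G R H * cls H.
Proof.
move=> sG sH; rewrite -[X in X ≤ _]mulr1.
apply: (@pth_least (H, R) (fun v => pth (H, R) v * cls H) 1) => //=.
  rewrite mulr1 -{1}(atom_idem sH); exact/kle_mulr/(@pth_refl (H, R)).
by move=> G0 S a G' sG0 sG' aa; rewrite mulrA; apply/kle_mulr/pth_step.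
Qed.

Lemma strsum_source G R H : atoms s G -> atoms s H ->
  strsum G R H ≤ cls G * strsum G R H.
Proof.
move=> sG sH; rewrite -[X in X ≤ _]mulr1.
apply: (@pth_least (H, R) (fun v => cls v.1 * pth (H, R) v) 1) => //=.
  rewrite mulr1 -{1}(atom_idem sH); exact/kle_mull/(@pth_refl (H, R)).
move=> G0 S a G' sG0 sG' aa.
apply: kle_trans (kle_mull _ (pth_step (H, R) S sG0 sG' aa)).
rewrite !clsM !mulrA atom_idem //; apply: kle_mulr.
exact/kle_mul1l/atom_le1.
Qed.

Lemma strsum_mul G R H R' H' : atoms s G -> atoms s H -> atoms s H' ->
  strsum G R H * strsum H R' H' ≤ strsum G (mul R R') H'.
Proof.
move=> sG sH sH'.
(* Left translation by [R] preserves edges, which act on the right; it moves paths starting at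
   [(H, one)] to paths starting at [(H, R)]. *)
have shift : strsum H R' H' ≤ pth (H', mul R R') (H, R).
  rewrite -[X in X ≤ _]mulr1 -[in (H, R)](Monoid.mulm1 mul R).
  apply: (@pth_least (H', R')
            (fun v => pth (H', mul R R') (v.1, mul R v.2)) 1) => //=.
    by rewrite mulr1; exact: (@pth_refl (H', _)).
  by move=> *; rewrite Monoid.mulmA; exact: pth_step.
apply: kle_trans (kle_mull _ shift) _.
apply: (@pth_least (H, R) (pth (H', mul R R'))) => //=.
  exact/kle_mul1r/atom_le1.
by move=> *; exact: pth_step.
Qed.

Lemma strsum_mul0 G R H H1 R' H' :
  atoms s G -> atoms s H -> atoms s H1 -> atoms s H' -> H <> H1 ->
  strsum G R H * strsum H1 R' H' = 0.
Proof.
move=> sG sH sH1 sH' HH; apply: kle_eq0.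
apply: kle_trans (kle_mul (strsum_target _ sG sH) (strsum_source _ sH1 sH')) _.
by rewrite mulrA -(mulrA _ (cls H)) atom_disjoint // mulr0 mul0r.
Qed.

Fixpoint hword G (l : seq (Sigma * expr Sigma Pi)) : W :=
  if l is (a, H) :: l' then mul (lam G a H) (hword H l') else one.

Lemma hword_cat G l l' :
  hword G (l ++ l') = mul (hword G l) (hword (glast (G, l)) l').
Proof.
rewrite /glast /=; elim: l G => [|[a H] l IH] G /=; first by rewrite Monoid.mul1m.
by rewrite IH Monoid.mulmA.
Qed.

(* All strings with the same end points and the same image in [W] as [w]. *)
Definition class_sum w := strsum w.1 (hword w.1 w.2) (glast w).

(** Half of being the least upper bound of the class sums: lying below every upper bound. The
    contexts [c] and [d] make it pass through products. *)
Definition continuous e := forall c d z,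
  (forall w, can_interp s e w -> c * class_sum w * d ≤ z) -> c * cls e * d ≤ z.

Lemma interp_atoms e w : can_interp s e w ->
  atoms s w.1 /\ atoms s (glast w).
Proof.
by move=> /can_interp_CS ws; case: (glast_atom ws) => ? _; case: ws => [[? _] _].
Qed.

(** Strings that do not fuse have distinct middle atoms, whose product is 0; for the others, [hword]
    is multiplicative along fusion. *)
Lemma class_sum_mul (L L' : set (gstring Sigma Pi)) u v :
    L `<=` CS s -> L' `<=` CS s -> L u -> L' v ->
  class_sum u * class_sum v = 0 \/
  exists2 w, fusion L L' w & class_sum u * class_sum v ≤ class_sum w.
Proof.
move=> Ls Ls' Lu Lv; have us := Ls _ Lu; have vs := Ls' _ Lv.
have [su _] := us.1; have [tu _] := glast_atom us.
have [sv _] := vs.1; have [tv _] := glast_atom vs.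
have [uv|uv] := pselect (glast u = v.1); last by left; exact: strsum_mul0.
right; exists (u.1, u.2 ++ v.2); first exact: fusion_inP.
rewrite {3}/class_sum /= hword_cat -/(glast _) glast_cat.
rewrite -surjective_pairing uv -surjective_pairing {1}/class_sum uv.
by apply: strsum_mul => //; rewrite -uv.
Qed.

(** Atoms and [W] are finite, so even an infinite language meets only finitely many classes. *)
Lemma class_sum_sup (L : set (gstring Sigma Pi)) : L `<=` CS s ->
  exists X, (forall w, L w -> class_sum w ≤ X) /\
    forall c d z, (forall w, L w -> c * class_sum w * d ≤ z) -> c * X * d ≤ z.
Proof.
move=> Ls.
(* The pair [((G, _), (H, R))] codes the class from [G] to [H] with label [R]. *)
pose F (p : V * V) := strsum p.1.1 p.2.2 p.2.1.
pose P (p : V * V) := exists2 w, L w &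
  [/\ w.1 = p.1.1, hword w.1 w.2 = p.2.2 & glast w = p.2.1].
exists (fsup (List.list_prod vertices vertices) P F); split.
  move=> w Lw; have ws := Ls _ Lw; have [sw _] := ws.1.
  have [tw _] := glast_atom ws.
  apply: (@fsup_ub _ _ _ _ P F ((w.1, one), (glast w, hword w.1 w.2))).
    by apply: List.in_prod; exact/verticesP.
  by exists w.
move=> c d z Lz; apply: fsup_le => -[[G S] [H R]] _ [w Lw /= [wG wR wH]].
by rewrite /F /= -wR -wH -wG; exact: Lz.
Qed.

(** The supremum [X] of the classes of [Star e] is above 1 and closed under left multiplication by
    [e], so star induction applies. *)
Lemma continuous_star e : continuous e -> continuous (Star e).
Proof.
move=> IH c d z cz.
have [X [X1 X2]] := class_sum_sup (@can_interp_CS _ _ s (Star e)).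
suff eX : cls (Star e) ≤ X.
  by apply: kle_trans (X2 c d z cz); apply/kle_mulr/kle_mull.
rewrite -[cls _]mulr1 clsS; apply: kstar_ind.
  rewrite -[X in X ≤ _]mulr1; apply: atoms_cover => G cG; rewrite mul1r mulr1.
  apply: kle_trans (strsum_refl cG.1) _; apply: (X1 (G, [::])).
  by exists 0%N => //; exists G.
rewrite -[cls e]mul1r; apply: IH => u eu; rewrite mul1r -[_ * X]mulr1.
apply: X2 => v [n _ ev]; rewrite mulr1.
have [->//|[w uvw le]] := class_sum_mul (@can_interp_CS _ _ s e)
  (@can_interp_CS _ _ s (Star e)) eu (ex_intro2 _ _ n I ev).
apply: kle_trans le _; apply: X1.
case: uvw => u' [v' [eu' [m _ ev'] uv' ->]].
by exists m.+1 => //; exists u', v'.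
Qed.

Lemma continuous_mul e f :
  continuous e -> continuous f -> continuous (e * f)%kad.
Proof.
move=> IHe IHf c d z cz; rewrite clsM mulrA -mulrA.
apply: IHe => u eu; rewrite mulrA; apply: IHf => v fv; rewrite -(mulrA c).
have [->|[w uvw le]] := class_sum_mul (@can_interp_CS _ _ s e)
  (@can_interp_CS _ _ s f) eu fv; first by rewrite mulr0 mul0r.
by apply: kle_trans (cz w uvw); apply/kle_mulr/kle_mull.
Qed.

End Paths.
End Strings.

(** * Completeness of the canonical interpretation *)

Section RelationMonoid.
Variable n : nat.
Implicit Types R S : {set 'I_n * 'I_n}.

Definition rel_one : {set 'I_n * 'I_n} := [set p | p.1 == p.2]%SET.
Definition rel_mul R S : {set 'I_n * 'I_n} :=
  [set p | [exists j, ((p.1, j) \in R) && ((j, p.2) \in S)]]%SET.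

Lemma rel_mulP R S i k :
  reflect (exists2 j, (i, j) \in R & (j, k) \in S) ((i, k) \in rel_mul R S).
Proof. by rewrite inE /=; apply: (iffP exists_inP). Qed.

Lemma rel_mulA : associative rel_mul.
Proof.
move=> R S T; apply/setP=> -[i l]; apply/rel_mulP/rel_mulP.
  case=> j Rij /rel_mulP [k Sjk Tkl]; exists k => //.
  by apply/rel_mulP; exists j.
case=> k /rel_mulP [j Rij Sjk] Tkl; exists j => //.
by apply/rel_mulP; exists k.
Qed.

Lemma rel_mul1l : left_id rel_one rel_mul.
Proof.
move=> R; apply/setP=> -[i k]; apply/rel_mulP/idP.
  by case=> j; rewrite inE /= => /eqP ->.
by move=> Rik; exists i; rewrite // inE.
Qed.

Lemma rel_mul1r : right_id rel_one rel_mul.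
Proof.
move=> R; apply/setP=> -[i k]; apply/rel_mulP/idP.
  by case=> j Rij; rewrite inE /= => /eqP <-.
by move=> Rik; exists k; rewrite // inE.
Qed.

HB.instance Definition _ := Monoid.isLaw.Build {set 'I_n * 'I_n} rel_one rel_mul
  rel_mulA rel_mul1l rel_mul1r.

End RelationMonoid.

Fixpoint actions (Sigma Pi : Type) (e : expr Sigma Pi) : seq Sigma :=
  match e with
  | Act a => [:: a]
  | Prp _ | Zero | One => [::]
  | Add e1 e2 | Mul e1 e2 => actions e1 ++ actions e2
  | Bot e1 | Top e1 | Star e1 => actions e1
  end.

Lemma acts_in_sub (Sigma Pi : Type) (l l' : seq Sigma) (e : expr Sigma Pi) :
  (forall a, List.In a l -> List.In a l') -> acts_in l e -> acts_in l' e.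
Proof.
move=> ll; elim: e => //=.
  by move=> e IHe f IHf [/IHe ? /IHf ?].
by move=> e IHe f IHf [/IHe ? /IHf ?].
Qed.

Lemma acts_in_actions (Sigma Pi : Type) (e : expr Sigma Pi) :
  acts_in (actions e) e.
Proof.
have in_cat (l l' : seq Sigma) a :
    List.In a l \/ List.In a l' -> List.In a (l ++ l').
  exact: (List.in_or_app l l').
elim: e => //=; first by left.
  by move=> e IHe f IHf; split; [move: IHe|move: IHf]; apply: acts_in_sub => a al;
    apply: in_cat; tauto.
by move=> e IHe f IHf; split; [move: IHe|move: IHf]; apply: acts_in_sub => a al;
  apply: in_cat; tauto.
Qed.

Section Completeness.
Variables (Sigma Pi : Type) (s : seq (expr Sigma Pi)) (Gamma : set (expr Sigma Pi)).
Hypotheses (FLG : FL_closed Gamma) (enum_s : enumerates s Gamma).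
Local Open Scope classical_set_scope.
Local Open Scope ring_scope.
Implicit Types (e f g G H phi : expr Sigma Pi) (w : gstring Sigma Pi).

Lemma enum_parameters : parameters s.
Proof. by move=> x xs; exact/(FL_parameter _ FLG)/enum_s.1. Qed.
Let ps := enum_parameters.

Lemma Gamma_decide phi G : Gamma phi -> atoms s G ->
  cls G ≤ cls phi \/ cls G ≤ kbot (cls phi).
Proof.
move=> /enum_s.2 [x xs phix] [t st <-].
by rewrite (iffRL (clsP _ _) phix); exact: (choice_decide ps st xs).
Qed.

(** One direction of the truth lemma for the diamond [Top (e * phi)]. *)
Definition truthful e := forall w phi, can_interp s e w -> is_formula phi ->
  Gamma (Top (e * phi)) -> cls (glast w) ≤ cls phi ->
  cls w.1 ≤ cls (Top (e * phi)).

(** Quantified over all labellings: the antidomain case uses a trivial monoid, the final comparison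
    an automaton. *)
Definition always_continuous e :=
  forall (W : finType) (one : W) (mul : Monoid.law one)
    (lam : expr Sigma Pi -> Sigma -> expr Sigma Pi -> W) (acts : seq Sigma),
  acts_in acts e -> continuous s mul lam acts e.

(** By continuity it suffices to annihilate each class sum, and each starts with an atom other than
    [G]. *)
Lemma no_string_mul0 e G : always_continuous e -> atoms s G ->
  fusion [set (G, [::])] (can_interp s e) = set0 -> cls G * cls e = 0.
Proof.
move=> ce sG eG; apply: kle_eq0; rewrite -[_ * cls e]mulr1.
(* Relations on an empty state set form the one-element monoid; only first atoms matter here. *)
apply: (ce _ _ (@rel_mul 0) (fun _ _ _ => finset.set0) (actions e)).
  exact: acts_in_actions.
move=> w ew; rewrite mulr1; have [sw tw] := interp_atoms ew.
apply: kle_trans (kle_mull _ (strsum_source ps _ _ _ _ sw tw)) _.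
rewrite mulrA (atom_disjoint ps sG sw) ?mul0r // => Gw.
by have /starts_with : exists2 w, can_interp s e w & w.1 = G by exists w.
Qed.

Lemma interp_bot_le e G : always_continuous e ->
  can_interp s (Bot e) (G, [::]) -> cls G ≤ cls (Bot e).
Proof.
move=> ce [x [[sG _] eG] [xG]]; rewrite xG in sG eG; rewrite clsB.
by apply: compl_mul0_bot; [exact: atom_compl sG|exact: no_string_mul0].
Qed.

(** Truthfulness at [phi = 1] puts the first atom below the domain of [e], which the antidomain
    annihilates. *)
Lemma truthful_starts e w : tests_in Gamma (Bot e) -> truthful e ->
  can_interp s e w -> cls w.1 * kbot (cls e) = 0.
Proof.
move=> [Ge _] te ew; have [sw tw] := interp_atoms ew.
apply: kle_eq0; rewrite -(kbot_mul (kbot (cls e))); apply: kle_mulr.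
have := te w 1%kad ew isT Ge; rewrite clsT clsM mulr1; apply.
exact: atom_le1 tw.
Qed.

Lemma truthful_bot e : always_continuous e -> truthful (Bot e).
Proof.
move=> ce _ phi [G [[sG cG] eG] <-] fphi _ /= Gphi.
have Ge : cls G ≤ cls (Bot e) by apply: interp_bot_le => //; exists G.
rewrite clsT; apply: compl_dom_le; first exact: atom_compl sG.
by rewrite clsM -(atom_idem ps sG); exact: kle_mul.
Qed.

(** Induction on the number of iterations: the later ones make [Star e * phi] possible where the
    first ends, and [FL_starl] provides the test needed to carry this back. *)
Lemma truthful_star e : truthful e -> truthful (Star e).
Proof.
move=> te w phi [n _ +] fphi Gphi; elim: n w => [|n IHn] w.
  move=> [G [sG _] <-] /= Gle; rewrite clsT.
  apply: compl_dom_le; first exact: atom_compl sG.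
  apply: kle_trans Gle _; rewrite clsM -[X in X ≤ _]mul1r clsS.
  exact/kle_mulr/kstar1.
move=> [u [v [eu ev uv ->]]]; rewrite glast_cat -surjective_pairing uv.
rewrite -surjective_pairing => /(IHn _ ev) IH /=.
have := te u (Bot (Bot (Star e * phi))) eu isT (FL_starl _ FLG _ _ fphi Gphi).
rewrite uv => /(_ _)/kle_trans; apply; first by rewrite !clsB -clsT.
rewrite !(clsT, clsM) !clsB -kbot_local; apply: kdom_mono.
by rewrite clsM mulrA clsS; apply/kle_mulr/kstarM.
Qed.

(** [v] puts the middle atom below the domain of [f * phi]; [u] carries this to the front, and
    locality removes the double antidomain. *)
Lemma truthful_mul e f : truthful e -> truthful f -> truthful (e * f)%kad.
Proof.
move=> te tf _ phi [u [v [eu fv uv ->]]] fphi Gphi.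
rewrite glast_cat -surjective_pairing uv -surjective_pairing => vphi /=.
have [Gf Ge] := FL_mull _ FLG _ _ _ fphi Gphi.
have := te u (Bot (Bot (f * phi))) eu isT Ge.
rewrite uv => /(_ _)/kle_trans; apply; first by rewrite !clsB -clsT; exact: tf.
by rewrite !(clsT, clsM) !clsB -kbot_local !clsM mulrA.
Qed.

(** The first atom decides the test because [Gamma] contains it; a negative decision would make
    [G * Act a * H] zero. *)
Lemma truthful_act a : truthful (Act a).
Proof.
move=> w phi [ws [G [H [wE GaH]]]] fphi Gphi; rewrite wE /glast /= => Hphi.
have [[sG _] _] := ws; rewrite wE /= in sG.
have [//|Gbot] := Gamma_decide Gphi sG.
case: GaH; apply/clsP; apply: kle_eq0.
rewrite !clsM -mulrA; move: Gbot; rewrite clsT kbot_triple clsM => Gbot.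
rewrite -(kbot_mul (cls (Act a) * cls phi)).
by apply: kle_mul => //; exact: kle_mull.
Qed.

Lemma consistent_string0 G a H : consistent_atoms s G -> consistent_atoms s H ->
  cls (G * Act a * H)%kad <> 0 -> can_interp s (Act a) (G, [:: (a, H)]).
Proof.
move=> cG cH GaH; split; last by exists G, H; split=> // /clsP.
by split=> //= aG [<-|].
Qed.

(** The two are proved together: continuity of [Bot e] needs truthfulness of [e], and truthfulness
    of [Bot e] needs continuity of [e]. *)
Lemma continuous_truthful e :
  tests_in Gamma e -> always_continuous e /\ truthful e.
Proof.
elim: e => /=.
- move=> a _; split; last exact: truthful_act.
  move=> W one mul lam acts /= aa c d z cz; rewrite -mulrA.
  apply: (atoms_cover ps) => G cG; rewrite mulrA.
  apply: (atoms_cover ps) => H cH.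
  have -> : c * cls G * cls (Act a) * cls H = c * cls (G * Act a * H)%kad.
    by rewrite !clsM !mulrA.
  have [->|GaH] := pselect (cls (G * Act a * H)%kad = 0).
    by rewrite mulr0 mul0r.
  apply: kle_trans (cz _ (consistent_string0 cG cH GaH)).
  apply/kle_mulr/kle_mull; rewrite /class_sum /= Monoid.mulm1.
  by case: cG cH => [sG _] [sH _]; exact: strsum_letter.
- move=> p Gp; split; last first.
    move=> _ phi [G [[sG cG] Gle] <-] /= fphi _ Gphi; rewrite clsT.
    apply: compl_dom_le; first exact: atom_compl sG.
    rewrite clsM -(atom_idem ps sG); apply: kle_mul => //.
    by rewrite /kle -clsD; apply/clsP.
  move=> W one mul lam acts _ c d z cz; rewrite -mulrA.
  apply: (atoms_cover ps) => G [sG cG]; rewrite mulrA -(mulrA c).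
  have [Gle|Gle] := Gamma_decide Gp sG; last first.
    suff -> : cls G * cls (Prp p) = 0 by rewrite mulr0 mul0r.
    by apply: kle_eq0; rewrite -(kbot_mul (cls (Prp p))); exact: kle_mulr.
  have Gp' : can_interp s (Prp p) (G, [::]).
    by exists G => //; split=> //; apply/clsP; rewrite clsD.
  apply: kle_trans (cz _ Gp'); apply/kle_mulr/kle_mull.
  apply: kle_trans (strsum_refl mul lam acts sG).
  apply: kle_mul1l; apply: compl_le1; exact: (@formula_compl _ _ (Prp p)).
- by move=> _; split=> // W one mul lam acts _ c d z _; rewrite cls0 mulr0 mul0r.
- move=> _; split; last first.
    move=> _ phi [G [sG cG] <-] fphi _ /= Gphi; rewrite clsT.
    apply: compl_dom_le; first exact: atom_compl sG.
    by rewrite clsM mul1r.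
  move=> W one mul lam acts _ c d z cz; rewrite cls1 mulr1.
  apply: (atoms_cover ps) => G cG.
  have G1 : can_interp s 1%kad (G, [::]) by exists G.
  apply: kle_trans (cz _ G1); apply/kle_mulr/kle_mull.
  exact: (strsum_refl mul lam acts cG.1).
- move=> e IHe f IHf [/IHe [ce te] /IHf [cf tf]]; split.
    move=> W one mul lam acts [ae af] c d z cz.
    rewrite clsD mulrDr mulrDl; apply: kadd_le.
      by apply: (ce W one mul lam acts ae) => w ew; apply: cz; left.
    by apply: (cf W one mul lam acts af) => w fw; apply: cz; right.
  move=> w phi efw fphi Gphi wphi; have [Ge Gf] := FL_addl _ FLG _ _ _ fphi Gphi.
  case: efw => [ew|fw].
    apply: kle_trans (te _ _ ew fphi Ge wphi) _.
    by rewrite !clsT !clsM clsD mulrDl; apply/kdom_mono/kle_addl.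
  apply: kle_trans (tf _ _ fw fphi Gf wphi) _.
  by rewrite !clsT !clsM clsD mulrDl; apply/kdom_mono/kle_addr.
- move=> e IHe f IHf [/IHe [ce te] /IHf [cf tf]]; split.
    move=> W one mul lam acts [ae af].
    by apply: (continuous_mul ps); [exact: ce|exact: cf].
  exact: truthful_mul.
- move=> e IHe Ge; have [_ /IHe [ce te]] := Ge; split; last exact: truthful_bot.
  move=> W one mul lam acts ae c d z cz; rewrite -mulrA.
  apply: (atoms_cover ps) => G cG; rewrite mulrA -(mulrA c) clsB.
  (* Either no string of [e] starts at [G], and [G] is a string of [Bot e], or truthfulness makes
     [G * Bot e] zero. *)
  have [eG|] := pselect (fusion [set (G, [::])] (can_interp s e) = set0).
    have Ge' : can_interp s (Bot e) (G, [::]) by exists G.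
    apply: kle_trans (cz _ Ge'); apply/kle_mulr/kle_mull.
    apply: kle_trans (strsum_refl mul lam acts cG.1).
    exact/kle_mul1l/compl_le1/compl_bot.
  move=> /starts_with [w ew <-]; rewrite (truthful_starts Ge te ew).
  by rewrite mulr0 mul0r.
- by [].
- move=> e IHe /IHe [ce te]; split; last exact: truthful_star.
  by move=> W one mul lam acts ae; apply: (continuous_star ps); exact: ce.
Qed.

(* [traced Q q G l]: some run through the nondeterministic automaton with
   states [Q] and its most permissive transitions starts at [q] and reads the
   string [(G, l)]. *)
Fixpoint traced (Q : seq (kad Sigma Pi)) (q : kad Sigma Pi) G
    (l : seq (Sigma * expr Sigma Pi)) : Prop :=
  if l is (a, H) :: l' then
    exists r, [/\ r \in Q, cls (G * Act a * H)%kad * r ≤ q & traced Q r H l']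
  else cls G ≤ q.

Lemma traced_sub (Q Q' : seq (kad Sigma Pi)) q q' G l :
  {subset Q <= Q'} -> q ≤ q' -> traced Q q G l -> traced Q' q' G l.
Proof.
move=> QQ; elim: l q q' G => [|[a H] l IH] q q' G qq /=.
  by move/kle_trans; apply.
case=> r [/QQ rQ le rl]; exists r; split=> //; first exact: kle_trans qq.
exact: IH rl.
Qed.

(** As for partial derivatives of a product, a state [r] of the first factor becomes [r * q']. *)
Lemma traced_cat (Q Q' : seq (kad Sigma Pi)) q q' G l l' : CS s (G, l) ->
  traced Q q G l -> traced Q' q' (glast (G, l)) l' ->
  traced (map (fun r => r * q') Q ++ Q') (q * q') G (l ++ l').
Proof.
elim: l q G => [|[a H] l IH] q G sGl /=; last first.
  case=> r [rQ le rl] rl'; exists (r * q'); split.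
  - by rewrite mem_cat (map_f (fun r => r * q') rQ).
  - by rewrite mulrA; exact: kle_mulr.
  - apply: IH => //; split; first by apply: (sGl.2 (a, H)); left.
    by move=> aG aGl; apply: sGl.2; right.
rewrite /glast /= => Gq; have [[sG _] _] := sGl.
case: l' => [|[a H] l'] /=.
  by move=> Gq'; rewrite -(atom_idem ps sG); exact: kle_mul.
case=> r [rQ' le rl']; exists r; split; first by rewrite mem_cat rQ' orbT.
  (* Of two copies of the idempotent [G], one ends the first run below [q] and the other starts the
     second below [q']. *)
  rewrite !clsM -{1}(atom_idem ps sG) -!mulrA; apply: kle_mul => //.
  by rewrite !mulrA -!clsM.
by apply: traced_sub rl' => // x; rewrite mem_cat => ->; rewrite orbT.
Qed.

(** A single finite set of partial derivatives serves all strings of [e]. *)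
Lemma traceable e : tests_in Gamma e ->
  exists Q, forall w, can_interp s e w -> traced Q (cls e) w.1 w.2.
Proof.
elim: e => /=.
- move=> a _; exists [:: 1] => w [ws [G [H [wE _]]]].
  rewrite {}wE in ws *; case: ws => /= -[sG _] /(_ (a, H) (or_introl erefl)).
  case=> sH _; exists 1; rewrite inE eqxx mulr1; split=> //=; last first.
    exact: atom_le1 sH.
  rewrite !clsM; apply: (@kle_trans _ _ (cls G * cls (Act a))).
    exact/kle_mul1l/(atom_le1 ps sH).
  exact/kle_mul1r/(atom_le1 ps sG).
- move=> p _; exists [::] => _ [G [_ Gle] <-] /=.
  by rewrite /kle -clsD; apply/clsP.
- by move=> _; exists [::].
- by move=> _; exists [::] => _ [G [sG _] <-] /=; exact: atom_le1 sG.
- move=> e IHe f IHf [/IHe [Q eQ] /IHf [Q' fQ']].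
  exists (Q ++ Q') => w [/eQ|/fQ']; apply: traced_sub; rewrite ?clsD.
  + by move=> x; rewrite mem_cat => ->.
  + exact: kle_addl.
  + by move=> x; rewrite mem_cat orbC => ->.
  + exact: kle_addr.
- move=> e IHe f IHf [/IHe [Q eQ] /IHf [Q' fQ']].
  exists (map (fun r => r * cls f) Q ++ Q') => _ [u [v [eu fv uv ->]]] /=.
  rewrite clsM; apply: traced_cat.
  + by rewrite -surjective_pairing; exact: (can_interp_CS _ _ _ eu).
  + exact: eQ.
  + by rewrite -surjective_pairing uv; exact: fQ'.
- move=> e _ [_ Ge]; exists [::] => w ew.
  case: (ew) => G _ Gw; rewrite -Gw /= in ew *.
  by apply: interp_bot_le => //; exact: (continuous_truthful Ge).1.
- by [].
- move=> e IHe /IHe [Q eQ]; exists (map (fun r => r * cls (Star e)) Q).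
  move=> w [n _]; elim: n w => [|n IHn] w.
    move=> [G [sG _] <-] /=; rewrite clsS; apply: kle_trans (kstar1 _).
    exact: atom_le1 sG.
  move=> [u [v [eu ev uv ->]]] /=.
  have := @traced_cat Q (map (fun r => r * cls (Star e)) Q) (cls e)
            (cls (Star e)) u.1 u.2 v.2.
  rewrite -surjective_pairing uv.
  move=> /(_ (can_interp_CS _ _ _ eu) (eQ _ eu) (IHn _ ev)).
  apply: traced_sub; last by rewrite clsS; exact: kstarM.
  by move=> x; rewrite mem_cat => /orP[].
Qed.

Lemma interp_sub_le e f : tests_in Gamma e -> tests_in Gamma f ->
  can_interp s f `<=` can_interp s e -> cls f ≤ cls e.
Proof.
move=> Ge Gf fe; have [Q eQ] := traceable Ge.
(* State [0] stands for [cls e], and [lam] sends a letter to its full transition relation. *)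
pose Q' := cls e :: Q; pose n := size Q; pose q (i : 'I_n.+1) := Q'`_i.
pose lam G a H : {set 'I_n.+1 * 'I_n.+1} :=
  [set p | `[< cls (G * Act a * H)%kad * q p.2 ≤ q p.1 >]]%SET.
pose hw := hword (@rel_mul n.+1) lam.
(* A run becomes a pair in the label, a property shared by all strings of the class. *)
have tracedP G l i : traced Q (q i) G l ->
    exists2 j, (i, j) \in hw G l & cls (glast (G, l)) ≤ q j.
  elim: l i G => [|[a H] l IH] i G /=; first by exists i; rewrite // inE.
  move=> [r [rQ le rl]].
  have rQ' : r \in Q' by rewrite inE rQ orbT.
  have rn : (index r Q' < n.+1)%N by move: rQ'; rewrite -index_mem.
  have rE : q (Ordinal rn) = r by rewrite /q nth_index.
  rewrite -rE in rl; have [j ij jH] := IH _ _ rl; exists j => //.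
  apply/rel_mulP; exists (Ordinal rn) => //.
  by rewrite inE; apply/asboolP; rewrite rE.
have cf := (continuous_truthful Gf).1 _ _ (@rel_mul n.+1) lam _ (acts_in_actions f).
rewrite -[cls f]mul1r -[_ * _]mulr1; apply: cf => w /fe ew; rewrite mul1r.
have [sw tw] := interp_atoms ew.
have [j ij jH] := tracedP _ _ ord0 (eQ _ ew).
rewrite -surjective_pairing in jH.
(* The supremum of the states reached from state [0] under the label [v.2]. It satisfies the path
   inequalities, and at the empty prefix it is at most [cls e], hence so is the class sum. *)
pose y (v : expr Sigma Pi * {set 'I_n.+1 * 'I_n.+1}) :=
  fsup (enum 'I_n.+1) (fun r => (ord0, r) \in v.2) q.
have y_ub (v : expr Sigma Pi * {set 'I_n.+1 * 'I_n.+1}) r :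
    (ord0, r) \in v.2 -> q r ≤ y v.
  move=> rv; apply: (@fsup_ub _ _ _ _ (fun r => (ord0, r) \in v.2)) => //.
  by apply/In_mem; rewrite mem_enum.
apply: (@kle_trans _ _ (y (w.1, rel_one n.+1))); last first.
  rewrite -[y _]mulr1; apply: fsup_le_right => r _; rewrite inE /= => /eqP <-.
  by rewrite mulr1.
rewrite /class_sum /strsum; apply: pth_least => //.
  by rewrite mulr1; apply: kle_trans jH _; exact: y_ub.
move=> G S a G' sG sG' aa; rewrite -[_ * y _]mulr1.
apply: fsup_le => r _ /rel_mulP [k Sk]; rewrite inE mulr1 => /asboolP le.
by apply: kle_trans le _; exact: y_ub.
Qed.

End Completeness.

(** * Relational models *)

Section Relational.
Variables Sigma Pi : Type.
Local Open Scope classical_set_scope.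
Implicit Types (e f G H phi : expr Sigma Pi) (M : relModel Sigma Pi).

Lemma rel_interp_sound M e f : e === f -> rel_interp M e = rel_interp M f.
Proof.
elim=> //=.
- by move=> ? ? ? _ -> _ ->.
- by move=> ? ? ? ? _ -> _ ->.
- by move=> ? ? ? ? _ -> _ ->.
- by move=> ? ? _ ->.
- by move=> ? ? _ ->.
- by move=> ? ? _ ->.
- by move=> *; exact: setUA.
- by move=> *; exact: setUC.
- by move=> *; exact: setU0.
- by move=> *; exact: setUid.
- move=> e1 e2 e3; apply/seteqP; split=> -[x z] /=.
    by case=> y [xy [t [yt tz]]]; exists t; split=> //; exists y.
  by case=> t [[y [xy yt]] tz]; exists y; split=> //; exists t.
- move=> e1; apply/seteqP; split=> -[x z] /=; first by case=> y [-> ].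
  by move=> xz; exists x.
- move=> e1; apply/seteqP; split=> -[x z] /=; first by case=> y [? <-].
  by move=> xz; exists z.
- by move=> e1; apply/seteqP; split=> -[x z] //= [y []].
- by move=> e1; apply/seteqP; split=> -[x z] //= [y []].
- move=> e1 e2 e3; apply/seteqP; split=> -[x z] /=.
    by case=> y [[xy|xy] yz]; [left|right]; exists y.
  by case=> -[y [xy yz]]; exists y; split=> //; [left|right].
- move=> e1 e2 e3; apply/seteqP; split=> -[x z] /=.
    by case=> y [xy [yz|yz]]; [left|right]; exists y.
  by case=> -[y [xy yz]]; exists y; split=> //; [left|right].
- move=> e1; apply/setUidPr => -[x z] /= [->|[y [xy yz]]].
    exact: Relation_Operators.rt_refl.
  by apply: Relation_Operators.rt_trans yz; exact: Relation_Operators.rt_step.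
- move=> e1; apply/setUidPr => -[x z] /= [->|[y [xy yz]]].
    exact: Relation_Operators.rt_refl.
  apply: (Relation_Operators.rt_trans _ _ _ _ _ xy).
  exact: Relation_Operators.rt_step.
- move=> e1 e2 e3 _ /setUidPr le; apply/setUidPr => -[x z] /= [y [xy yz]].
  have {yz} : rel_interp M e3 (y, z) by apply: le; left.
  elim: xy => // [{}x {}y xy yz|x1 x2 x3 _ IH1 _ IH2 /IH2/IH1 //].
  by apply: le; right; exists y.
- move=> e1 e2 e3 _ /setUidPr le; apply/setUidPr => -[x z] /= [y [xy yz]].
  have {xy} : rel_interp M e3 (x, y) by apply: le; left.
  elim: yz => // [{}y {}z yz xy|x1 x2 x3 _ IH1 _ IH2 /IH1/IH2 //].
  by apply: le; right; exists y.
- move=> e1; apply/seteqP; split=> -[x z] //= [y [[<- nx] xz]].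
  by apply: nx; exists z.
- move=> e1 e2; apply/seteqP; split=> -[x z] /= [<- nx]; split=> // -[y].
    by case=> t [xt [ty [u tu]]]; apply: nx; exists u, t.
  by case=> t [xt ty]; apply: nx; exists t, t; do !split=> //; exists y.
- move=> e1; apply/seteqP; split=> -[x z] /=; first by case=> -[].
  move=> <-; have [xe|xe] := pselect (exists y, rel_interp M e1 (x, y)).
    by right.
  by left.
- move=> p; apply/seteqP; split=> -[x z] /=.
    by case=> <- [y []].
  by case=> <- px; split=> //; exists x.
- move=> e1; apply/seteqP; split=> -[x z] /= [<- xe]; split=> //.
    by case=> y [_ ny]; exact: ny.
  by apply: contrapT => nx; apply: xe; exists x.
Qed.

(* The Cayley representation of the language algebra: a language acts on
   strings by fusion on the right. *)
Definition string_model s : relModel Sigma Pi := RelModel Sigma Pi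
  (gstring Sigma Pi)
  (fun a => [set ww | exists u, [/\ can_interp s (Act a) u, glast ww.1 = u.1
                               & ww.2 = (ww.1.1, ww.1.2 ++ u.2)]])
  (fun p => [set w | can_interp s (Prp p) (glast w, [::])]).

(** The carrier also has strings ending in an expression that is no consistent atom; there the
    identity relates [w] to itself but [lang_one] has no matching string. *)
Lemma rel_interp_string s e w w' : consistent_atoms s (glast w) ->
  rel_interp (string_model s) e (w, w') <->
  exists u, [/\ can_interp s e u, glast w = u.1 & w' = (w.1, w.2 ++ u.2)].
Proof.
have fix_w x : x = (x.1, x.2 ++ [::]) :> gstring Sigma Pi.
  by rewrite cats0 -surjective_pairing.
have last_cat' x (u : gstring Sigma Pi) :
    glast x = u.1 -> glast (x.1, x.2 ++ u.2) = glast u.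
  by move=> xu; rewrite glast_cat -surjective_pairing xu -surjective_pairing.
elim: e w w' => //=.
- move=> p w w' cw; split.
    by case=> <- pw; exists (glast w, [::]); split.
  by case=> _ [[G [cG Gp] <-] /= wG ->]; rewrite -fix_w wG; split=> //; exists G.
- by move=> w w' _; split=> // -[u []].
- move=> w w' cw; split.
    by move=> <-; exists (glast w, [::]); split=> //; exists (glast w).
  by case=> _ [[G cG <-] _ ->]; rewrite -fix_w.
- move=> e IHe f IHf w w' cw; split.
    by case=> [/(IHe _ _ cw)|/(IHf _ _ cw)] [u [? ? ?]]; exists u; split=> //;
      [left|right].
  case=> u [[eu|fu] wu ww'].
    by left; apply/(IHe _ _ cw); exists u.
  by right; apply/(IHf _ _ cw); exists u.
- move=> e IHe f IHf w w' cw; split.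
    case=> x [/(IHe _ _ cw) [u [eu wu xE]]].
    have cx : consistent_atoms s (glast x).
      by rewrite xE last_cat'//; exact/glast_atom/(can_interp_CS _ _ _ eu).
    move=> /(IHf _ _ cx) [v [fv xv ->]]; exists (u.1, u.2 ++ v.2); split=> //.
      by apply: fusion_inP => //; rewrite -xv xE last_cat'.
    by rewrite xE /= catA.
  case=> _ [[u [v [eu fv uv ->]]] /= wu ->]; exists (w.1, w.2 ++ u.2); split.
    by apply/(IHe _ _ cw); exists u.
  have cu : consistent_atoms s (glast (w.1, w.2 ++ u.2)).
    by rewrite last_cat'//; exact/glast_atom/(can_interp_CS _ _ _ eu).
  by apply/(IHf _ _ cu); exists v; split=> //=; rewrite ?last_cat' ?catA.
- move=> e IHe w w' cw; split.
    case=> <- nw; exists (glast w, [::]); split=> //; exists (glast w) => //.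
    split=> //; apply: contrapT => /starts_with [u eu uw]; apply: nw.
    by exists (w.1, w.2 ++ u.2); apply/(IHe _ _ cw); exists u.
  case=> _ [[G [cG Ge] <-] /= wG ->]; rewrite -fix_w; split=> // -[x].
  move/(IHe _ _ cw) => [u [eu wu _]].
  have /starts_with // : exists2 u, can_interp s e u & u.1 = G.
  by exists u; rewrite // -wu.
- move=> e IHe w w' cw; split.
    case=> <- [x /(IHe _ _ cw) [u [eu wu _]]]; exists (glast w, [::]); split=> //.
    by exists (glast w) => //; split=> //; apply/starts_with; exists u.
  case=> _ [[G [cG /starts_with [u eu uG]] <-] /= wG ->]; rewrite -fix_w.
  split=> //; exists (w.1, w.2 ++ u.2); apply/(IHe _ _ cw); exists u.
  by rewrite wG uG.
- move=> e IHe w w' cw; split.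
    move=> /= /(Operators_Properties.clos_rt_rt1n _ _ _ _) ww'.
    elim: ww' cw => [{}w|{}w x {}w' wx _ IH] cw.
      exists (glast w, [::]); split=> //.
      by exists 0 => //; exists (glast w).
    have [u [eu wu xE]] := (IHe _ _ cw).1 wx.
    have [|v [[n _ ev] xv ->]] := IH.
      by rewrite xE last_cat'//; exact/glast_atom/(can_interp_CS _ _ _ eu).
    exists (u.1, u.2 ++ v.2); split=> //; last by rewrite xE /= catA.
    exists n.+1 => //; apply: fusion_inP => //.
    by rewrite -xv xE last_cat'.
  case=> u [[n _ eu] wu ->]; elim: n w u cw eu wu => [|n IHn] w u cw.
    by case=> G _ <- _; rewrite -fix_w; exact: Relation_Operators.rt_refl.
  case=> [u1 [u2 [eu1 eu2 u12 ->]]] /= wu.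
  have cu : consistent_atoms s (glast (w.1, w.2 ++ u1.2)).
    by rewrite last_cat'//; exact/glast_atom/(can_interp_CS _ _ _ eu1).
  apply: (Relation_Operators.rt_trans _ _ _ (w.1, w.2 ++ u1.2)).
    by apply: Relation_Operators.rt_step; apply/(IHe _ _ cw); exists u1.
  rewrite catA; apply: (IHn (w.1, w.2 ++ u1.2) u2) => //.
  by rewrite last_cat'.
Qed.

(** A string [u] is recovered from the action on its first atom, which leads from [(u.1, [::])] to
    [u]. *)
Lemma string_model_faithful s e f :
  rel_interp (string_model s) e = rel_interp (string_model s) f ->
  can_interp s e = can_interp s f.
Proof.
have sub e1 e2 : rel_interp (string_model s) e1 = rel_interp (string_model s) e2 ->
    can_interp s e1 `<=` can_interp s e2.
  move=> e12 u e1u; have [cu _] := can_interp_CS _ _ _ e1u.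
  have : rel_interp (string_model s) e1 ((u.1, [::]), u).
    by apply/rel_interp_string => //; exists u; split=> //; case: (u).
  rewrite e12 => /(@rel_interp_string s e2 (u.1, [::]) u cu) [v [e2v /= uv ->]].
  by rewrite /glast /= in uv; rewrite uv -surjective_pairing.
by move=> ef; apply/seteqP; split; apply: sub.
Qed.

Lemma can_interp_sound s e f : e === f -> can_interp s e = can_interp s f.
Proof. by move=> ef; apply/string_model_faithful/rel_interp_sound. Qed.

End Relational.

(** * Finiteness of the Fischer--Ladner closure *)

Section FischerLadner.
Variables Sigma Pi : Type.
Local Open Scope classical_set_scope.
Implicit Types (e f x y z phi k : expr Sigma Pi) (E C S : set (expr Sigma Pi)).

Lemma replace_top_keq e : e === replace_top e.
Proof.
elim: e => /=; try by move=> *; exact: keq_refl.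
- by move=> e IHe f IHf; exact: keq_add.
- by move=> e IHe f IHf; exact: keq_mul.
- by move=> e IHe; exact: keq_bot.
- move=> e IHe; apply: keq_trans (keq_top_botbot _) _.
  exact/keq_bot/keq_bot.
- by move=> e IHe; exact: keq_star.
Qed.

Lemma replace_top_free e : top_free (replace_top e).
Proof. by elim: e => //= e -> f ->. Qed.

Lemma is_parameter_Top e : is_parameter (Top e) <-> top_free e.
Proof.
split; first by case=> [[f [->]]|[p]].
by move=> efree; left; exists e.
Qed.

(** Ensures that the closure, an intersection of closed supersets, consists of parameters. *)
Lemma parameters_FL_closed : FL_closed (@is_parameter Sigma Pi).
Proof.
split=> //.
- by move=> p _; right; exists p.
- exact/is_parameter_Top.
- exact/is_parameter_Top.
- by move=> e f _ _ /is_parameter_Top/andP[? ?]; split; apply/is_parameter_Top.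
- by move=> e f _ _ /is_parameter_Top/andP[? ?]; split; apply/is_parameter_Top.
- by move=> e /is_parameter_Top ?; apply/is_parameter_Top.
- by move=> e _ /is_parameter_Top ?; apply/is_parameter_Top/andP.
- by move=> e /is_parameter_Top ?; apply/is_parameter_Top/andP.
- move=> e f phi _ /is_parameter_Top/andP[/andP[? ?] ?].
  by split; apply/is_parameter_Top/andP.
- move=> e f phi _ /is_parameter_Top/andP[/andP[? ?] ?].
  by split; apply/is_parameter_Top; [apply/andP|apply/and3P].
- move=> e phi _ /is_parameter_Top/andP[? ?].
  by apply/is_parameter_Top; apply/and3P.
Qed.

Lemma FL_closure_sub S C : FL_closed C -> S `<=` C -> FL_closure S `<=` C.
Proof. by move=> Cc SC x; apply. Qed.

Lemma sub_FL_closure S : S `<=` FL_closure S.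
Proof. by move=> x Sx C [_]; apply. Qed.

Lemma FL_closure_closed S : S `<=` @is_parameter Sigma Pi ->
  FL_closed (FL_closure S).
Proof.
move=> Sp; split.
- by apply: FL_closure_sub => //; exact: parameters_FL_closed.
- by move=> p Gp C CS; apply: (FL_prp _ CS.1); exact: Gp.
- by move=> C CS; exact: (FL_one _ CS.1).
- by move=> C CS; exact: (FL_zero _ CS.1).
- by move=> e f fe ff Gef; split=> C CS;
    have [] := FL_add _ CS.1 _ _ fe ff (Gef C CS).
- by move=> e f fe ff Gef; split=> C CS;
    have [] := FL_mul _ CS.1 _ _ fe ff (Gef C CS).
- by move=> e Ge C CS; apply: (FL_star _ CS.1); exact: Ge.
- by move=> e e1 Ge C CS; apply: (FL_mul1 _ CS.1) => //; exact: Ge.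
- by move=> e Ge C CS; apply: (FL_bot _ CS.1); exact: Ge.
- by move=> e f phi fphi Gef; split=> C CS;
    have [] := FL_addl _ CS.1 _ _ _ fphi (Gef C CS).
- by move=> e f phi fphi Gef; split=> C CS;
    have [] := FL_mull _ CS.1 _ _ _ fphi (Gef C CS).
- by move=> e phi fphi Ge C CS; apply: (FL_starl _ CS.1) => //; exact: Ge.
Qed.

Lemma St_parameters E : St E `<=` @is_parameter Sigma Pi.
Proof.
by move=> _ [e [f [_ _ _ ->]]]; apply/is_parameter_Top/replace_top_free.
Qed.

Lemma tests_in_replace_top C e : FL_closed C ->
  (forall f, subexpr e f -> is_formula f -> C (test_of f)) ->
  tests_in C (replace_top e).
Proof.
move=> CC; elim: e => //=.
- by move=> p Cp; apply: (FL_prp _ CC); apply: (Cp (Prp p)) => //; left.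
- by move=> e IHe f IHf Cef; split; [apply: IHe|apply: IHf] => g eg;
    apply: Cef; right; [left|right].
- by move=> e IHe f IHf Cef; split; [apply: IHe|apply: IHf] => g eg;
    apply: Cef; right; [left|right].
- move=> e IHe Ce; split; last by apply: IHe => g eg; apply: Ce; right.
  by apply: (FL_bot _ CC); apply: (Ce (Bot e)) => //; left.
- move=> e IHe Ce.
  have C1 : C (Top (Bot (replace_top e) * 1)).
    by apply: (FL_bot _ CC); apply: (Ce (Top e)) => //; left.
  split=> //; split; last by apply: IHe => g eg; apply: Ce; right.
  (* With [e] for [replace_top e], the chain is [Top (Bot (Bot e))], [Top (Bot e * 1)],
     [Top (Bot e)], [Top (e * 1)]. *)
  by have [/(FL_bot _ CC)] := FL_mul _ CC (Bot (replace_top e)) 1%kad isT isT C1.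
- by move=> e IHe Ce; apply: IHe => g eg; apply: Ce; right.
Qed.

(* Arguments of the tests reached from [Top (e * k)] by the rules on products. *)
Fixpoint continuations e k : set (expr Sigma Pi) :=
  [set (e * k)%kad] `|`
  match e with
  | Add f g => continuations f k `|` continuations g k
  | Mul f g => continuations g k `|` continuations f (g * k)
  | Star f => continuations f (Star f * k)
  | _ => set0
  end.

Fixpoint components e : set (expr Sigma Pi) :=
  [set e] `|`
  match e with
  | Add f g => components f `|` components g
  | Mul f g => (components f `|` components g) `|` continuations f g
  | Star f => components f `|` continuations f (Star f)
  | Bot f | Top f => components f
  | _ => set0
  end.

(** The closure rules on arguments of tests, with [g * (h * k)] in place of [g * Bot (Bot (h * k))].
    The member [f * Star f] serves [Star f * phi] when [phi] is a variant of 1. *)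
Definition step e : set (expr Sigma Pi) :=
  match e with
  | Add f g => [set f; g]
  | Mul f k => [set f; k] `|`
      match f with
      | Add g h => [set (g * k)%kad; (h * k)%kad]
      | Mul g h => [set (h * k)%kad; (g * (h * k))%kad]
      | Star g => [set (g * (Star g * k))%kad]
      | _ => set0
      end
  | Star f => [set f; (f * Star f)%kad]
  | Bot f => [set f]
  | _ => set0
  end.

Lemma continuations_refl e k : continuations e k (e * k)%kad.
Proof. by case: e => *; left. Qed.

Lemma components_refl e : components e e.
Proof. by case: e => *; left. Qed.

Lemma step_mul f k x : step (f * k)%kad x ->
  [\/ components f x, x = k |
    match f with
    | Add g h => [set (g * k)%kad; (h * k)%kad] x
    | Mul g h => [set (h * k)%kad; (g * (h * k))%kad] x
    | Star g => [set (g * (Star g * k))%kad] x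
    | _ => False
    end].
Proof.
move=> [[->|->]|fx]; [|by constructor 2|by constructor 3; case: f fx].
by constructor 1; exact: components_refl.
Qed.

(** Unfolding a star leads back to [Star f * k], which is itself a continuation, so nothing new is
    generated. *)
Lemma continuations_step e k z : continuations e k z ->
  step z `<=` [set x | [\/ components e x, x = k | continuations e k x]].
Proof.
have cR := continuations_refl.
elim: e k z => [a|p|||f IHf g IHg|f IHf g IHg|f IHf|f IHf|f IHf] k z.
- by case=> [->|[]] x /step_mul[?|?|[]]; [constructor 1|constructor 2].
- by case=> [->|[]] x /step_mul[?|?|[]]; [constructor 1|constructor 2].
- by case=> [->|[]] x /step_mul[?|?|[]]; [constructor 1|constructor 2].
- by case=> [->|[]] x /step_mul[?|?|[]]; [constructor 1|constructor 2].
- case=> [->|[/IHf fz|/IHg gz]] x.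
  + move=> /step_mul[?|?|[->|->]]; [by constructor 1|by constructor 2| |].
      by constructor 3; right; left.
    by constructor 3; right; right.
  + move=> /fz[?|?|?]; [|by constructor 2|by constructor 3; right; left].
    by constructor 1; right; left.
  + move=> /gz[?|?|?]; [|by constructor 2|by constructor 3; right; right].
    by constructor 1; right; right.
- case=> [->|[/IHg gz|/IHf fz]] x.
  + move=> /step_mul[?|?|[->|->]]; [by constructor 1|by constructor 2| |].
      by constructor 3; right; left.
    by constructor 3; right; right.
  + move=> /gz[?|?|?]; [|by constructor 2|by constructor 3; right; left].
    by constructor 1; right; left; right.
  + move=> /fz[?|->|?]; [|by constructor 3; right; left|
      by constructor 3; right; right].
    by constructor 1; right; left; left.
- by case=> [->|[]] x /step_mul[?|?|[]]; [constructor 1|constructor 2].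
- by case=> [->|[]] x /step_mul[?|?|[]]; [constructor 1|constructor 2].
- case=> [->|/IHf fz] x.
  + move=> /step_mul[?|?|->]; [by constructor 1|by constructor 2|].
    by constructor 3; right.
  + move=> /fz[?|->|?]; [|by constructor 3; left|by constructor 3; right].
    by constructor 1; right; left.
Qed.

Lemma components_step e z : components e z -> step z `<=` components e.
Proof.
have pR := components_refl; have cR := continuations_refl.
elim: e z => [a|p|||f IHf g IHg|f IHf g IHg|f IHf|f IHf|f IHf] z.
- by case=> [->|[]] x [].
- by case=> [->|[]] x [].
- by case=> [->|[]] x [].
- by case=> [->|[]] x [].
- case=> [->|[/IHf fz|/IHg gz]] x.
  + by case=> ->; right; [left|right].
  + by move=> /fz ?; right; left.
  + by move=> /gz ?; right; right.
- have fg x : [\/ components f x, x = g | continuations f g x] ->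
      components (f * g)%kad x.
    by case=> [?|->|?]; right; [left; left|left; right|right].
  case=> [->|[[/IHf fz|/IHg gz]|/continuations_step fgz]] x.
  + move=> xs; apply: fg; apply: continuations_step xs; exact: cR.
  + by move=> /fz ?; right; left; left.
  + by move=> /gz ?; right; left; right.
  + by move=> /fgz; exact: fg.
- case=> [->|/IHf fz] x; first by move=> ->; right.
  by move=> /fz ?; right.
- by case=> [->|/IHf fz] x // /fz ?; right.
- case=> [->|[/IHf fz|/continuations_step fz]] x.
  + by case=> ->; right; [left|right].
  + by move=> /fz ?; right; left.
  + by move=> /fz[?|->|?]; [right; left|left|right; right].
Qed.

Lemma finite_continuations e k : finite_set (continuations e k).
Proof.
elim: e k => [a|p|||f IHf g IHg|f IHf g IHg|f IHf|f IHf|f IHf] k;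
  by rewrite /= !finite_setU; do !split=> //; exact: finite_set1.
Qed.

Lemma finite_components e : finite_set (components e).
Proof.
have fc := finite_continuations.
elim: e => [a|p|||f IHf g IHg|f IHf g IHg|f IHf|f IHf|f IHf];
  by rewrite /= !finite_setU; do !split=> //; exact: finite_set1.
Qed.

Lemma finite_subexpr e : finite_set (subexpr e).
Proof.
elim: e => [a|p|||f IHf g IHg|f IHf g IHg|f IHf|f IHf|f IHf];
  by rewrite /= !finite_setU; do !split=> //; exact: finite_set1.
Qed.

(* The argument [z] of a test in the closure is a syntactic variant of some
   [y] in a finite set: up to [===], [Top z] is [Top y], or [Bot y] if the
   flag is set. *)
Inductive variant : bool -> expr Sigma Pi -> expr Sigma Pi -> Prop :=
| variant_refl y : variant false y y
| variant_bot b y z : variant b y z -> variant (~~ b) y (Bot z)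
| variant_mul b y z phi :
    variant b y z -> variant false 1 phi -> variant b y (z * phi)
| variant_cong e k phi :
    variant false k phi -> variant false (e * k) (e * phi).

Lemma variant_botbot y z : variant false y z -> variant false y (Bot (Bot z)).
Proof. by move=> yz; exact/(@variant_bot true)/(@variant_bot false). Qed.

(** By locality only the domain of a right factor matters, so a trailing variant of 1 disappears and
    [phi] may be exchanged for [k]. *)
Lemma variant_sound b y z : variant b y z ->
  Top z === if b then Bot y else Top y.
Proof.
move=> yz; apply/clsP.
have -> : cls (if b then Bot y else Top y) =
  if b then kbot (cls y) else kbot (kbot (cls y)).
  by case: b {yz}; rewrite ?clsT ?clsB.
rewrite clsT; elim: yz => {b y z} //.
- by move=> b y z _ IH; rewrite clsB IH; case: b {IH} => //=; rewrite kbot_triple.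
- move=> b y z phi _ <- _ phi1; rewrite clsM kbot_local phi1.
  by rewrite kbot1 kbot0 mulr1.
- by move=> e k phi _ kphi; rewrite !clsM kbot_local kphi -kbot_local.
Qed.

(** * Closure of the variants under the Fischer--Ladner rules *)

Section Variants.
Variable C : set (expr Sigma Pi).
Hypotheses (C0 : C 0%kad) (C1 : C 1%kad)
  (Cstep : forall y, C y -> step y `<=` C).

Definition is_variant z := exists b y, C y /\ variant b y z.

Definition variant_parameters : set (expr Sigma Pi) :=
  [set x | (exists z, [/\ x = Top z, top_free z & is_variant z]) \/
           (exists2 p, x = Prp p & C (Prp p))].

Lemma is_variant_refl z : C z -> is_variant z.
Proof. by move=> Cz; exists false, z; split=> //; exact: variant_refl. Qed.

(** A sum is a variant only of itself, as the other constructors build products and antidomains. *)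
Lemma is_variant_add e f : is_variant (e + f)%kad -> C e /\ C f.
Proof.
case=> b [y [Cy yef]]; inversion yef; subst.
by split; apply: (Cstep Cy); [left|right].
Qed.

Lemma is_variant_mul e f :
  is_variant (e * f)%kad -> is_variant e /\ is_variant f.
Proof.
case=> b [y [Cy yef]]; inversion yef as [| |? ? ? ? ye f1|? k ? kf]; subst.
- by split; apply/is_variant_refl/(Cstep Cy); left; [left|right].
- by split; [exists b, y|exists false, 1%kad].
- split; first by apply/is_variant_refl/(Cstep Cy); left; left.
  by exists false, k; split=> //; apply: (Cstep Cy); left; right.
Qed.

Lemma is_variant_star e : is_variant (Star e) -> C e /\ C (e * Star e)%kad.
Proof.
case=> b [y [Cy yef]]; inversion yef; subst.
by split; apply: (Cstep Cy); [left|right].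
Qed.

Lemma is_variant_mul1 e : is_variant e -> is_variant (e * 1)%kad.
Proof.
case=> b [y [Cy ye]]; exists b, y; split=> //.
by apply: variant_mul => //; exact: variant_refl.
Qed.

Lemma is_variant_bot e : is_variant (Bot e) -> is_variant e.
Proof.
case=> b [y [Cy yef]]; inversion yef as [|b' ? ? ye| |]; subst.
  exact/is_variant_refl/(Cstep Cy).
by exists b', y.
Qed.

Lemma is_variant_addl e f phi : is_variant ((e + f) * phi)%kad ->
  is_variant (e * phi)%kad /\ is_variant (f * phi)%kad.
Proof.
case=> b [y [Cy yef]]; inversion yef as [| |? ? ? ? ye phi1|? k ? kphi]; subst.
- by split; apply/is_variant_refl/(Cstep Cy); right; [left|right].
- have [Ce Cf] : C e /\ C f by apply: is_variant_add; exists b, y.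
  split; [exists false, e|exists false, f]; split=> //;
    by apply: variant_mul => //; exact: variant_refl.
- split; [exists false, (e * k)%kad|exists false, (f * k)%kad];
    split; try exact: variant_cong.
    by apply: (Cstep Cy); right; left.
  by apply: (Cstep Cy); right; right.
Qed.

Lemma is_variant_mull e f phi : is_variant ((e * f) * phi)%kad ->
  is_variant (f * phi)%kad /\ is_variant (e * Bot (Bot (f * phi)))%kad.
Proof.
case=> b [y [Cy yef]]; inversion yef as [| |? ? ? ? ye phi1|? k ? kphi]; subst.
- have Cf : C (f * phi)%kad by apply: (Cstep Cy); right; left.
  split; first exact: is_variant_refl.
  exists false, (e * (f * phi))%kad; split.
    by apply: (Cstep Cy); right; right.
  exact/variant_cong/variant_botbot/variant_refl.
- inversion ye as [| |? ? ? ? ye' f1|? k ? kf]; subst.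
  + have ff : variant false f (f * phi)%kad.
      by apply: variant_mul => //; exact: variant_refl.
    split; first by exists false, f; split=> //; apply: (Cstep Cy); left; right.
    by exists false, (e * f)%kad; split=> //; exact/variant_cong/variant_botbot.
  (* Both [f] and [phi] are variants of 1, so the new product is a variant of the same [y] as
     [e]. *)
  + have ff : variant false 1%kad (f * phi)%kad by exact: variant_mul.
    split; first by exists false, 1%kad.
    by exists b, y; split=> //; apply: variant_mul => //; exact: variant_botbot.
  + have ff : variant false k (f * phi)%kad by exact: variant_mul.
    split; first by exists false, k; split=> //; apply: (Cstep Cy); left; right.
    by exists false, (e * k)%kad; split=> //; exact/variant_cong/variant_botbot.
- have ff : variant false (f * k)%kad (f * phi)%kad by exact: variant_cong.
  split; [exists false, (f * k)%kad|exists false, (e * (f * k))%kad].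
    by split=> //; apply: (Cstep Cy); right; left.
  split; first by apply: (Cstep Cy); right; right.
  exact/variant_cong/variant_botbot.
Qed.

Lemma is_variant_starl e phi : is_variant (Star e * phi)%kad ->
  is_variant (e * Bot (Bot (Star e * phi)))%kad.
Proof.
case=> b [y [Cy yef]]; inversion yef as [| |? ? ? ? ye phi1|? k ? kphi]; subst.
- exists false, (e * (Star e * phi))%kad; split.
    by apply: (Cstep Cy); right.
  exact/variant_cong/variant_botbot/variant_refl.
- have [_ Ce] : C e /\ C (e * Star e)%kad by apply: is_variant_star; exists b, y.
  exists false, (e * Star e)%kad; split=> //.
  by apply/variant_cong/variant_botbot/variant_mul => //; exact: variant_refl.
- exists false, (e * (Star e * k))%kad; split; first by apply: (Cstep Cy); right.
  exact/variant_cong/variant_botbot/variant_cong.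
Qed.

Lemma variant_parameters_closed : FL_closed variant_parameters.
Proof.
have TopE z : variant_parameters (Top z) <-> top_free z /\ is_variant z.
  split; first by case=> [[_ [[<-]]]|[]].
  by case=> ? ?; left; exists z.
split.
- by move=> _ [[z [-> ? _]]|[p -> _]]; [left; exists z|right; exists p].
- move=> p /TopE [_ [b [y [Cy yp]]]]; right; exists p => //.
  by inversion yp; subst.
- by apply/TopE; split=> //; exact: is_variant_refl.
- by apply/TopE; split=> //; exact: is_variant_refl.
- move=> e f _ _ /TopE [/andP[? ?] /is_variant_add[? ?]].
  by split; apply/TopE; split=> //; exact: is_variant_refl.
- move=> e f _ _ /TopE [/andP[? ?] /is_variant_mul[? ?]].
  by split; apply/TopE.
- move=> e /TopE [? /is_variant_star[? _]].
  by apply/TopE; split=> //; exact: is_variant_refl.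
- move=> e _ /TopE [? ?]; apply/TopE; split; first exact/andP.
  exact: is_variant_mul1.
- move=> e /TopE [? /is_variant_bot ?]; apply/TopE; split; first exact/andP.
  exact: is_variant_mul1.
- move=> e f phi _ /TopE [/andP[/andP[? ?] ?] /is_variant_addl[? ?]].
  by split; apply/TopE; split=> //; apply/andP.
- move=> e f phi _ /TopE [/andP[/andP[? ?] ?] /is_variant_mull[? ?]].
  by split; apply/TopE; split=> //; [apply/andP|apply/and3P].
- move=> e phi _ /TopE [/andP[? ?] /is_variant_starl ?].
  by apply/TopE; split=> //; apply/and3P.
Qed.

Lemma variant_parameters_finite : finite_set C ->
  exists2 N, finite_set N &
    forall x, variant_parameters x -> exists2 y, N y & x === y.
Proof.
move=> finC; exists ((Bot @` C `|` Top @` C) `|` C).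
  by rewrite !finite_setU; do !split=> //; exact: finite_image.
move=> _ [[z [-> _ [b [y [Cy /variant_sound yz]]]]]|[p -> Cp]].
  exists (if b then Bot y else Top y) => //.
  by left; case: b {yz}; [left|right]; exists y.
by exists (Prp p); [right|exact: keq_refl].
Qed.

End Variants.

(** [N] may leave [C]: each of its elements is replaced by an equal member of [C] if there is one,
    and dropped otherwise. *)
Lemma enumerates_exists C N : finite_set N ->
  (forall x, C x -> exists2 y, N y & x === y) -> exists s, enumerates s C.
Proof.
move=> /finite_seqP [l ->] CN.
suff [s [sC ls]] : exists s, (forall x, List.In x s -> C x) /\
    forall x y, C x -> y \in l -> x === y -> exists2 z, List.In z s & x === z.
  by exists s; split=> // x Cx; have [y /= yl xy] := CN x Cx; exact: ls yl xy.
elim: l {CN} => [|y l [s [sC ls]]]; first by exists [::].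
have [[x [Cx xy]]|nx] := pselect (exists x, C x /\ x === y).
  exists (x :: s); split; first by move=> z [<-|/sC].
  move=> x' y' Cx'; rewrite inE => /predU1P[->|yl] xy'.
    by exists x; [left|exact: keq_trans xy' (keq_sym _ _ xy)].
  by have [z zs xz] := ls x' y' Cx' yl xy'; exists z => //; right.
exists s; split=> // x' y' Cx'; rewrite inE => /predU1P[->|yl] xy';
  last exact: ls yl xy'.
by case: nx; exists x'.
Qed.

Lemma FL_closure_enumerable E : finite_set E ->
  exists s, enumerates s (FL_closure (St E)).
Proof.
move=> finE.
pose X := \bigcup_(e in E) replace_top @` subexpr e.
(* [0] and [1] are included because every closed set contains their tests. *)
pose C := \bigcup_(x in [set 0%kad; 1%kad] `|` X) components x.
have finC : finite_set C.
  apply: bigcup_finite => [|x _]; last exact: finite_components.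
  rewrite !finite_setU; do !split; try exact: finite_set1.
  apply: bigcup_finite => // e _; apply: finite_image; exact: finite_subexpr.
have CX x : ([set 0%kad; 1%kad] `|` X) x -> C x.
  by move=> Xx; exists x => //; exact: components_refl.
have Cstep y : C y -> step y `<=` C.
  by case=> x Xx xy z yz; exists x => //; exact: components_step xy _ yz.
have C0 : C 0%kad by apply: CX; left; left.
have C1 : C 1%kad by apply: CX; left; right.
have closed := variant_parameters_closed C0 C1 Cstep.
have [N finN CN] := variant_parameters_finite finC.
apply: enumerates_exists finN _ => x Gx; apply: CN.
apply: FL_closure_sub closed _ _ Gx => _ [e [f [Ee ef _ ->]]]; left.
exists (replace_top f); split=> //; first exact: replace_top_free.
by apply: is_variant_refl; apply: CX; right; exists e => //; exists f.
Qed.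

End FischerLadner.

(** * Completeness for [E] and the equivalence of the three conditions *)

Lemma can_interp_complete (Sigma Pi : Type) (E : set (expr Sigma Pi))
    (s : seq (expr Sigma Pi)) (e f : expr Sigma Pi) :
  enumerates s (FL_closure (St E)) -> E e -> E f ->
  can_interp s e = can_interp s f -> e === f.
Proof.
move=> sE Ee Ef ef; have closed := FL_closure_closed (@St_parameters _ _ E).
have tests g : E g -> tests_in (FL_closure (St E)) (replace_top g).
  move=> Eg; apply: tests_in_replace_top => // h gh fh.
  by apply: sub_FL_closure; exists g, h.
(* Domains are rewritten as double antidomains, the form [tests_in] accepts; soundness keeps the
   canonical interpretation unchanged. *)
have toR g := can_interp_sound s (replace_top_keq g).
have ef' : can_interp s (replace_top e) = can_interp s (replace_top f).
  by rewrite -!toR.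
apply: keq_trans (replace_top_keq e) _.
apply: keq_trans (keq_sym _ _ (replace_top_keq f)).
by apply/clsP/kle_anti; apply: (interp_sub_le closed sE);
  rewrite ?ef' //; exact: tests.
Qed.

Theorem theorem6 (Sigma Pi : Type)
    (countable_Sigma : ([set: Sigma] #= [set: nat])%card)
    (countable_Pi : ([set: Pi] #= [set: nat])%card)
    (K : set (expr Sigma Pi))
    (E : set (expr Sigma Pi)) (finE : finite_set E)
    (e f : expr Sigma Pi) (Ee : E e) (Ef : E f) (Ke : K e) (Kf : K f) :
  (exists s : seq (expr Sigma Pi), enumerates s (FL_closure (St E))) /\
  (forall s : seq (expr Sigma Pi), enumerates s (FL_closure (St E)) ->
    [<-> keq_in K e f;
         can_interp s e = can_interp s f;
         forall M : relModel Sigma Pi, rel_interp M e = rel_interp M f]).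
Proof.
split=> [|s sE]; first exact: FL_closure_enumerable.
(* The cycle runs through soundness, then completeness with relational soundness, then faithfulness
   of the string model with completeness. *)
split; first by case=> _ _; exact: can_interp_sound.
split=> [ef M|ef].
  exact/rel_interp_sound/(can_interp_complete sE Ee Ef).
by split=> //; apply/(can_interp_complete sE Ee Ef)/string_model_faithful/ef.
Qed.
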